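(* Let $p>3$ be a prime, $r\ge4$ an integer, and let $\epsilon$ be either $1$ or a quadratic non-residue modulo $p$. Then the $p$-group $$G(p,r;\epsilon)=\langle a,b,c\mid a^p=b^p=c^{p^{r-2}}=[b,c]=1,\ [a,b^{-1}]=c^{\epsilon p^{r-3}},\ [a,c]=b\rangle$$ is resistant, i.e. for every saturated fusion system $\mathcal F$ over $S=G(p,r;\epsilon)$ one has $N_{\mathcal F}(S)=\mathcal F$.
   Context: $[x,y]=x^{-1}y^{-1}xy$. A fusion system $\mathcal F$ over a finite $p$-group $S$ is a category whose objects are the subgroups of $S$, with $\mathrm{Hom}_S(P,Q)\subseteq \mathrm{Hom}_{\mathcal F}(P,Q)\subseteq \mathrm{Inj}(P,Q)$ (where $\mathrm{Hom}_S(P,Q)$ denotes maps induced by conjugation in $S$), and such that every morphism is an $\mathcal F$-isomorphism followed by an inclusion. $P,Q\le S$ are $\mathcal F$-conjugate if they are isomorphic in $\mathcal F$. $P\le S$ is fully centralized (resp. fully normalized) if $|C_S(P)|\ge|C_S(P')|$ (resp. $|N_S(P)|\ge |N_S(P')|$) for all $P'$ $\mathcal F$-conjugate to $P$. $\mathcal F$ is saturated if (I) every fully normalized $P$ is fully centralized and $\mathrm{Aut}_S(P)\in \mathrm{Syl}_p(\mathrm{Aut}_{\mathcal F}(P))$; (II) if $\varphi\in \mathrm{Hom}_{\mathcal F}(P,S)$ has $\varphi P$ fully centralized, then $\varphi$ extends to a morphism in $\mathrm{Hom}_{\mathcal F}(N_\varphi,S)$, where $N_\varphi=\{g\in N_S(P)\mid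 \varphi c_g\varphi^{-1}\in \mathrm{Aut}_S(\varphi P)\}$. The condition $N_{\mathcal F}(S)=\mathcal F$ means that every $\varphi\in\mathrm{Hom}_{\mathcal F}(Q,Q')$, for all $Q,Q'\le S$, is the restriction of some $\psi\in\mathrm{Aut}_{\mathcal F}(S)$. A $p$-group $S$ is resistant if this holds for every saturated fusion system over $S$. *)

(* Defs.v *)
From mathcomp Require Import all_boot all_fingroup all_solvable.

Set Implicit Arguments.
Unset Strict Implicit.
Unset Printing Implicit Defensive.

Local Open Scope group_scope.

(* A map P -> Q between subgroups of gT is represented by any function        *)
(* gT -> gT that restricts to it; its values outside P are irrelevant.        *)
(* Restrictions, inclusions and composites of maps are thus given by the same *)
(* function, by id, and by \o, respectively.                                  *)

Definition inj_hom (gT : finGroupType) (P Q : {group gT}) (f : gT -> gT) :=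
  [/\ {in P &, {morph f : x y / x * y}},
      {in P &, injective f}
    & {in P, forall x, f x \in Q}].

Definition iso_in (gT : finGroupType)
    (hom : {group gT} -> {group gT} -> pred (gT -> gT))
    (P Q : {group gT}) (f : gT -> gT) :=
  hom P Q f /\
  exists g : gT -> gT, [/\ hom Q P g, {in P, cancel f g} & {in Q, cancel g f}].

(* fhom P Q is only meaningful when P and Q are objects, i.e., subgroups of S.*)
(* fhom_ext says that it is a set of maps P -> Q rather than of functions on  *)
(* gT. Identities and inclusions are the case g = 1 of fhom_conj.             *)
Record fusion_system (gT : finGroupType) (S : {group gT}) := FusionSystem {
  fhom :> {group gT} -> {group gT} -> pred (gT -> gT);
  fhom_ext : forall (P Q : {group gT}) (f g : gT -> gT),
    P \subset S -> Q \subset S -> {in P, f =1 g} -> fhom P Q f = fhom P Q g;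
  fhom_comp : forall (P Q R : {group gT}) (f g : gT -> gT),
    P \subset S -> Q \subset S -> R \subset S ->
    fhom P Q f -> fhom Q R g -> fhom P R (g \o f);
  fhom_conj : forall (P Q : {group gT}) (g : gT),
    P \subset S -> Q \subset S -> g \in S -> P :^ g \subset Q ->
    fhom P Q (conjg^~ g);
  fhom_inj : forall (P Q : {group gT}) (f : gT -> gT),
    P \subset S -> Q \subset S -> fhom P Q f -> inj_hom P Q f;
  fhom_factor : forall (P Q : {group gT}) (f : gT -> gT),
    P \subset S -> Q \subset S -> fhom P Q f ->
    exists2 R : {group gT}, R \subset Q & iso_in fhom P R f
}.

Definition AutS (gT : finGroupType) (S P : {group gT}) : {set {perm gT}} :=
  conj_aut P @* 'N_S(P).

Canonical AutS_group (gT : finGroupType) (S P : {group gT}) :=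
  Eval hnf in [group of AutS S P].

Section FusionSystem.

Variables (gT : finGroupType) (S : {group gT}) (F : fusion_system S).
Implicit Types (P Q R : {group gT}) (phi : gT -> gT).

Definition AutF P : {set {perm gT}} := [set a in Aut P | F P P a].

Definition F_conjugate P Q :=
  [/\ P \subset S, Q \subset S & exists f, iso_in F P Q f].

Definition fully_centralized P :=
  forall Q, F_conjugate P Q -> #|'C_S(Q)| <= #|'C_S(P)|.

Definition fully_normalized P :=
  forall Q, F_conjugate P Q -> #|'N_S(Q)| <= #|'N_S(P)|.

(* Used with R = phi P: the element a of Aut_S(R) below is then the           *)
(* automorphism phi c_g phi^-1 of R.                                          *)
Definition Nphi P R phi : {set gT} :=
  [set g in 'N_S(P) |
    [exists a in AutS S R, [forall x in P, a (phi x) == phi (x ^ g)]]].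

Lemma Nphi_group_set P R phi : group_set (Nphi P R phi).
Proof.
apply/group_setP; split=> [|g h].
  rewrite inE group1; apply/existsP; exists 1; rewrite group1 /=.
  by apply/forall_inP=> x _; rewrite perm1 conjg1.
case/setIdP=> Ng /exists_inP[a Sa /forall_inP aP].
case/setIdP=> Nh /exists_inP[b Sb /forall_inP bP].
apply/setIdP; split; first exact: groupM.
apply/exists_inP; exists (a * b); first exact: groupM.
apply/forall_inP=> x Px; rewrite permM (eqP (aP x Px)) conjgM; apply: bP.
by rewrite memJ_norm //; case/setIP: Ng.
Qed.

Canonical Nphi_group P R phi := Group (Nphi_group_set P R phi).

Definition saturated (p : nat) : Prop :=
  (forall P, P \subset S -> fully_normalized P ->
     fully_centralized P /\ p.-Sylow(AutF P) (AutS S P)) /\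
  (forall P R phi, P \subset S -> R = phi @: P :> {set gT} ->
     F P S phi -> fully_centralized R ->
     exists2 psi : gT -> gT, F (Nphi_group P R phi) S psi & {in P, psi =1 phi}).

(* N_F(S) = F *)
Definition normalizer_eq : Prop :=
  forall (Q Q' : {group gT}) phi, Q \subset S -> Q' \subset S -> F Q Q' phi ->
  exists2 psi : {perm gT}, psi \in AutF S & {in Q, psi =1 phi}.

End FusionSystem.

Definition resistant (p : nat) (gT : finGroupType) (S : {group gT}) : Prop :=
  forall F : fusion_system S, saturated F p -> normalizer_eq F.

(* 0 is a square, so a non-residue is automatically prime to p. *)
Definition quadratic_nonresidue (p e : nat) : Prop :=
  forall x : nat, (x ^ 2 != e %[mod p])%N.

(* Main.v *)
Require Import Defs.
From mathcomp Require Import all_boot all_fingroup all_solvable.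
From mathcomp Require Import ssralg zmodp.

(* By Alperin's argument (downward induction on |P|, with P fully normalized) *)
(* it is enough that Aut_S(P) is normal in Aut_F(P) for every proper          *)
(* S-centric P whose F-automorphisms normalizing Aut_S(P) already extend.     *)
(* Put A = <b, c>, Z = <c^p> (central) and D = <b, c^p>. An S-centric P is    *)
(* either A or satisfies P :&: A = Z or D. If Aut_F(P) stabilizes a chain of  *)
(* subgroups of P with cyclic factors, its derived subgroup is a p-group and  *)
(* normality follows. Otherwise some element of Aut_F(P) moves M = P :&: A,   *)
(* and Aut_F(P) acts on a section of order p^2 by transvections with two      *)
(* different axes; a product of three of these stabilizes M and acts on P / M *)
(* as multiplication by 1/2. It extends to S, but an automorphism of S can    *)
(* only act on S / A as i with i^2 = 1: it multiplies c by some n (modulo     *)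
(* <b>), hence c^(p^(r-3)) by n, and [a, [a, c]] by i^2 n. So 4 = 1 mod p,    *)
(* which is excluded by p > 3.                                                *)

(** An obstruction to resistance would be a proper centric [P] having a section of order p^2 on
    which Aut_F(P) acts with several transvection axes. [resistance_criterion] makes this precise:
    an F-automorphism normalizing Aut_S(P) extends beyond [P], so normality of Aut_S(P) in Aut_F(P)
    lets every morphism climb up to [S].

    Write k = r - 3 and Z0 = <c^(p^k)>. The subgroup [A] is the centralizer of [b], [S, S] lies in
    [D], [S, D] lies in [Z0], and each step of Z < D < A < S has index p. Hence a proper [P] that
    contains [Z] but is not inside [A] meets [A] in [Z] or [D] ([meet_A]). When M = P :&: A is
    invariant, or [P] is abelian of type (p, p^n) with n > 1, [chain_Sylow_normal] gives normality.
    When M is moved in the other cases, the section is P / Z if M = D, and [P] itself if M = Z and k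
    = 1; conjugation by [c], respectively [b], is a transvection with axis M. [moved_section]
    combines it with a conjugate into an element that stabilizes M and has eigenvalues 2 and 1/2.
    That element extends to [S], contradicting [aut_square].

    All this requires [S] to have order p^r. The relations bound the order from above only;
    [presented_group_model] supplies the lower bound. *)

Set Implicit Arguments.
Unset Strict Implicit.
Unset Printing Implicit Defensive.

Local Open Scope group_scope.

(** * Alperin's reduction *)

Section Fusion.

Variables (gT : finGroupType) (S : {group gT}) (F : fusion_system S).
Implicit Types (P Q R : {group gT}) (f g : gT -> gT).

Definition extends_to_S P f :=
  exists2 psi : {perm gT}, psi \in AutF F S & {in P, psi =1 f}.

Lemma fhom_id P Q : P \subset Q -> Q \subset S -> F P Q id.
Proof.
move=> sPQ sQS; have sPS := subset_trans sPQ sQS.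
rewrite (@fhom_ext _ _ F _ _ id (conjg^~ 1)) // => [|x _]; last by rewrite conjg1.
by apply: fhom_conj; rewrite ?conjsg1.
Qed.

Lemma iso_in_image P R f : iso_in F P R f -> P \subset S -> R \subset S ->
  f @: P = R.
Proof.
case=> Ff [g [Fg fK gK]] sPS sRS; apply/setP=> y.
have [_ _ fP] := fhom_inj sPS sRS Ff; have [_ _ gP] := fhom_inj sRS sPS Fg.
apply/imsetP/idP=> [[x Px ->] | Ry]; first exact: fP.
by exists (g y); rewrite ?gP ?gK.
Qed.

Lemma fhom_iso P Q f : P \subset S -> Q \subset S -> F P Q f ->
  exists R, [/\ R \subset Q, f @: P = R & iso_in F P R f].
Proof.
move=> sPS sQS Ff; have [R sRQ isoR] := fhom_factor sPS sQS Ff.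
by exists R; rewrite (iso_in_image isoR) ?(subset_trans sRQ).
Qed.

Lemma fhom_corestrict P Q R f : P \subset S -> Q \subset S -> R \subset S ->
  f @: P \subset R -> F P Q f -> F P R f.
Proof.
move=> sPS sQS sRS sfPR Ff; have [R0 [sR0 fP [Ff0 _]]] := fhom_iso sPS sQS Ff.
have sR0R : R0 \subset R by rewrite -fP.
apply: (@fhom_comp _ _ F P R0 R f id) => //; first exact: subset_trans sR0R sRS.
exact: fhom_id.
Qed.

Lemma AutFP P a : reflect (a \in Aut P /\ F P P a) (a \in AutF F P).
Proof. by apply: (iffP setIdP) => -[? ?]. Qed.

Lemma AutF_sub P : AutF F P \subset Aut P.
Proof. by apply/subsetP=> a /AutFP[]. Qed.

Lemma AutF_group_set P : P \subset S -> group_set (AutF F P).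
Proof.
move=> sPS; apply/group_setP; split=> [|a b /AutFP[Aa Fa] /AutFP[Ab Fb]].
  apply/AutFP; rewrite group1; split=> //.
  by rewrite (@fhom_ext _ _ F _ _ _ id) ?fhom_id // => x _; rewrite perm1.
apply/AutFP; rewrite groupM //; split=> //.
rewrite (@fhom_ext _ _ F _ _ _ (b \o a)) ?(fhom_comp _ _ _ Fa) // => x _.
by rewrite permM.
Qed.

Lemma AutS_mem P a : a \in AutS S P ->
  exists2 h, h \in 'N_S(P) & {in P, forall x, a x = x ^ h}.
Proof.
case/morphimP=> h Nh NSh ->; exists h => // x Px; exact: norm_conj_autE.
Qed.

Lemma conj_aut_AutS P h : h \in 'N_S(P) -> conj_aut P h \in AutS S P.
Proof. by move=> Nh; apply: mem_morphim => //; case/setIP: Nh. Qed.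

Lemma mem_Nphi P R f h h' : h \in 'N_S(P) -> h' \in 'N_S(R) ->
  {in P, forall x, f x \in R} -> {in P, forall x, f x ^ h' = f (x ^ h)} ->
  h \in Nphi S P R f.
Proof.
move=> Nh Nh' fP fh; rewrite inE Nh; apply/exists_inP.
exists (conj_aut R h'); first exact: conj_aut_AutS.
apply/forall_inP=> x Px; rewrite norm_conj_autE ?fP ?fh //.
by case/setIP: Nh'.
Qed.

Lemma iso_in_AutF P a : P \subset S -> a \in AutF F P -> iso_in F P P a.
Proof.
move=> sPS AFa; have [Aa Fa] := AutFP _ _ AFa; split=> //.
exists a^-1; split=> [|x _|x _]; rewrite ?permK ?permKV //.
by have /AutFP[] := groupVr (G := Group (AutF_group_set sPS)) AFa.
Qed.

(** * Extending automorphisms of a fully normalized subgroup *)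

Section Step.

Variables (p : nat) (P : {group gT}).
Hypothesis satF : saturated F p.
Hypothesis sPS : P \subset S.
Hypothesis IH : forall Q f, (#|P| < #|Q|)%N -> Q \subset S -> F Q S f ->
  extends_to_S Q f.

(** Saturation extends [f] to N_f, which contains [Q] properly because of [h]. Being larger than
    [P], it falls under [IH]. *)
Lemma extend_Nphi Q R f h : #|Q| = #|P| -> Q \subset S -> R \subset S ->
  iso_in F Q R f -> fully_centralized F R ->
  h \notin Q -> h \in Nphi S Q R f -> extends_to_S Q f.
Proof.
move=> oQ sQS sRS isoR fcR Qh Nh; have [_ sat2] := satF.
have defR := iso_in_image isoR sQS sRS.
have FQR : F Q R f by case: isoR.
have FQ : F Q S f by apply: fhom_corestrict FQR; rewrite ?defR.
have [psi Fpsi psiE] := sat2 Q R f sQS (esym defR) FQ fcR.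
have [fM _ fR] := fhom_inj sQS sRS FQR.
have sQN : Q \subset Nphi_group S Q R f.
  apply/subsetP=> x Qx; apply: (@mem_Nphi _ _ _ _ (f x)) => //.
  - by rewrite inE (subsetP sQS) // (subsetP (normG _)).
  - by rewrite inE (subsetP sRS) ?(subsetP (normG _)) ?fR.
  move=> y Qy; apply: (mulgI (f x)).
  by rewrite -conjgC -!fM ?groupJ // -conjgC.
have [||chi AFchi chiE] := IH _ _ Fpsi.
- rewrite -oQ; apply/proper_card/properP; split=> //.
  by exists h.
- by apply/subsetP=> x /setIdP[/setIP[]].
by exists chi => // x Qx; rewrite chiE ?psiE // (subsetP sQN).
Qed.

Hypothesis pS : p.-group S.
Hypothesis prS : P \proper S.
Hypothesis fnP : fully_normalized F P.
Hypothesis nAutS : 'C_S(P) \subset P -> p.-Sylow(AutF F P) (AutS S P) ->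
  (forall B : {group {perm gT}}, B \subset AutF F P -> AutS S P <| B ->
     forall a, a \in B -> extends_to_S P a) ->
  AutS S P <| AutF F P.

(** In either case N_a is larger than [P]. If [P] is centric, normality of Aut_S(P) makes N_a equal
    to N_S(P); otherwise N_a contains any element of C_S(P) outside [P], which induces the
    identity. *)
Lemma extend_AutF a : a \in AutF F P -> extends_to_S P a.
Proof.
have [fcP sylP] := satF.1 P sPS fnP.
(* This is the premise required by [nAutS], obtained without it: if [b] normalizes Aut_S(P), then
   N_b is all of N_S(P). *)
have stepB (B : {group {perm gT}}) : B \subset AutF F P -> AutS S P <| B ->
    forall b, b \in B -> extends_to_S P b.
  move=> sB /andP[_ nB] b Bb; have AFb := subsetP sB b Bb.
  have /properP[_ [h Nh Ph]] :=
    nilpotent_proper_norm (pgroup_nil pS) prS.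
  apply: (@extend_Nphi P P b h) => //; first exact: iso_in_AutF.
  have Tb : conj_aut P h ^ b \in AutS S P.
    by rewrite memJ_norm ?conj_aut_AutS // (subsetP nB).
  have [Ab Fb] := AutFP _ _ AFb.
  have [h' Nh' h'E] := AutS_mem Tb.
  apply: (mem_Nphi Nh Nh') => x Px; first exact: Aut_closed.
  rewrite -h'E ?(Aut_closed Ab) // conjgE !permM permK norm_conj_autE //.
  by case/setIP: Nh.
have [cP | ncP] := boolP ('C_S(P) \subset P).
  have nT := nAutS cP sylP stepB.
  exact: (stepB (Group (AutF_group_set sPS))).
move=> AFa; have [h /setIP[Sh Ch] Ph] := subsetPn ncP.
have [Aa Fa] := AutFP _ _ AFa.
apply: (@extend_Nphi P P a h) => //; first exact: iso_in_AutF.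
have Nh : h \in 'N_S(P) by apply/setIP; split=> //; apply: (subsetP (cent_sub _)).
apply: (mem_Nphi Nh (group1 _)) => x Px; first exact: Aut_closed.
rewrite conjg1; congr (a _).
by rewrite conjgE -(centP Ch) // mulKg.
Qed.

End Step.

Lemma iso_in_trans P Q R f g : P \subset S -> Q \subset S -> R \subset S ->
  iso_in F P Q f -> iso_in F Q R g -> iso_in F P R (g \o f).
Proof.
move=> sP sQ sR [Ff [f' [Ff' fK f'K]]] [Fg [g' [Fg' gK g'K]]].
have [_ _ fQ] := fhom_inj sP sQ Ff; have [_ _ g'Q] := fhom_inj sR sQ Fg'.
split; first exact: fhom_comp Ff Fg.
exists (f' \o g'); split; first exact: fhom_comp Fg' Ff'.
  by move=> x Px /=; rewrite gK ?fK ?fQ.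
by move=> x Rx /=; rewrite f'K ?g'K ?g'Q.
Qed.

Lemma iso_in_sym P Q f : iso_in F P Q f ->
  exists g, [/\ iso_in F Q P g, {in P, cancel f g} & {in Q, cancel g f}].
Proof. by case=> Ff [g [Fg fK gK]]; exists g; split=> //; split=> //; exists f. Qed.

Lemma iso_in_card P Q f : P \subset S -> Q \subset S -> iso_in F P Q f ->
  #|Q| = #|P|.
Proof.
move=> sP sQ isoF; rewrite -(iso_in_image isoF) // card_in_imset //.
by case: isoF => Ff _; case: (fhom_inj sP sQ Ff).
Qed.

(** * Alperin's induction *)

Section Criterion.

Variable p : nat.
Hypothesis satF : saturated F p.
Hypothesis pS : p.-group S.
Hypothesis nAutS : forall P, P \proper S ->
  'C_S(P) \subset P -> p.-Sylow(AutF F P) (AutS S P) ->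
  (forall B : {group {perm gT}}, B \subset AutF F P -> AutS S P <| B ->
     forall a, a \in B -> extends_to_S P a) ->
  AutS S P <| AutF F P.

(** Transport along [f] sends Aut_S(Q) to a p-subgroup of Aut_F(P), which by Sylow lies in the
    conjugate of Aut_S(P) by some [x]. Then N_S(Q) is all of N for [x^-1 \o f], so this map extends
    to [S]; [x] extends by [extend_AutF], and the composite extends [f]. *)
Lemma extend_to_fully_normalized P Q f :
    P \proper S -> fully_normalized F P -> Q \subset S -> iso_in F Q P f ->
    (forall R g, (#|P| < #|R|)%N -> R \subset S -> F R S g -> extends_to_S R g) ->
  extends_to_S Q f.
Proof.
move=> prP fnP sQS isoF IH; have [sPS _] := andP prP.
have [fcP sylP] := satF.1 P sPS fnP.
have oQ : #|Q| = #|P| by rewrite (iso_in_card sQS sPS isoF).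
have imF := iso_in_image isoF sQS sPS.
have [FQP [g [Fg fK gK]]] := isoF.
have [fM fI fP] := fhom_inj sQS sPS FQP.
pose fm := Morphism fM.
have injf : 'injm fm by apply/injmP.
have imf : fm @* Q = P by rewrite morphimEdom.
pose u := Aut_isom injf (subxx Q).
have uE a : a \in Aut Q -> {in Q, forall x, u a (f x) = f (a x)}.
  exact: (Aut_isomE injf (subxx Q)).
have sTA : AutS S Q \subset Aut Q by apply: Aut_conj_aut.
have suT : [morphism of u] @* AutS S Q \subset AutF F P.
  apply/subsetP=> _ /morphimP[a Aa Ta ->]; apply/AutFP; split.
    by have:= Aut_Aut_isom injf (subxx Q) a; rewrite imf.
  have [h /setIP[Sh Nh] aE] := AutS_mem Ta.
  have FQQ : F Q Q (conjg^~ h) by apply: fhom_conj; rewrite ?(normP Nh).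
  rewrite (@fhom_ext _ _ F _ _ _ (f \o (conjg^~ h \o g))) //.
    by apply: fhom_comp FQP => //; apply: fhom_comp FQQ.
  have [_ _ gQ] := fhom_inj sPS sQS Fg.
  by move=> y Py /=; rewrite -aE ?gQ // -uE ?gK ?gQ.
have puT : p.-group ([morphism of u] @* AutS S Q).
  by rewrite morphim_pgroup // morphim_pgroup // (pgroupS (subsetIl _ _)).
pose A := Group (AutF_group_set sPS).
have [x Ax sux] := Sylow_subJ (G := A) sylP suT puT.
have AxV : x^-1 \in AutF F P by apply: (groupVr (G := A)).
have isoxf : iso_in F Q P (x^-1 \o f).
  by apply: iso_in_trans isoF (iso_in_AutF sPS AxV).
have /properP[_ [h Nh Qh]] : Q \proper 'N_S(Q).
  rewrite (nilpotent_proper_norm (pgroup_nil pS)) // properEcard sQS oQ.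
  exact: proper_card.
have [|chi AFchi chiE] := extend_Nphi satF IH oQ sQS sPS isoxf fcP Qh.
  have /(subsetP sux) : u (conj_aut Q h) \in [morphism of u] @* AutS S Q.
    apply: mem_morphim; last exact: conj_aut_AutS.
    by rewrite (subsetP sTA) ?conj_aut_AutS.
  case/imsetP=> b /AutS_mem[h' Nh' h'E] def_b.
  apply: (mem_Nphi Nh Nh') => y Qy /=.
    by rewrite (Aut_closed (subsetP (AutF_sub _) _ AxV)) ?fP.
  have Nh1 : h \in 'N(Q) by case/setIP: Nh.
  have TA : conj_aut Q h \in Aut Q by rewrite (subsetP sTA) ?conj_aut_AutS.
  rewrite -h'E ?(Aut_closed (subsetP (AutF_sub _) _ AxV)) ?fP //.
  rewrite -(norm_conj_autE Nh1) // -uE // def_b conjgE !permM permK //.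
have [psi AFpsi psiE] := extend_AutF satF sPS IH pS prP fnP (nAutS prP) Ax.
exists (chi * psi) => [|y Qy].
  by apply: (groupM (G := Group (AutF_group_set (subxx S)))).
rewrite permM chiE //= psiE ?permKV //.
by rewrite (Aut_closed (subsetP (AutF_sub _) _ AxV)) ?fP.
Qed.

Lemma fully_normalized_exists P : P \subset S -> exists2 Q : {group gT},
  F_conjugate F P Q & fully_normalized F Q.
Proof.
move=> sPS.
(* [F_conjugate] is a [Prop] over arbitrary functions; finite functions give an equivalent boolean
   predicate, over which |N_S(X)| can be maximized. *)
pose C := [pred X : {group gT} | (X \subset S) &&
  [exists f : {ffun gT -> gT}, F P X f && (f @: P == X)]].
have CP X : reflect (F_conjugate F P X) (C X).
  apply: (iffP andP) => [[sX /existsP[f /andP[Ff /eqP imf]]] | [_ sX [f isoF]]].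
    split=> //; exists f; have [R [_ imR isoR]] := fhom_iso sPS sX Ff.
    by have <- : R = X by apply: val_inj; rewrite /= -imR -imf.
  split=> //; apply/existsP; exists (finfun f).
  have eqf : {in P, finfun f =1 f} by move=> x _; rewrite ffunE.
  rewrite (fhom_ext F sPS sX eqf) isoF.1 /= (eq_in_imset eqf).
  by rewrite (iso_in_image isoF).
have C0 : C P.
  apply/CP; split=> //; exists id; split; first exact: fhom_id.
  by exists id; split=> //; apply: fhom_id.
case: (arg_maxnP (fun X : {group gT} => #|'N_S(X)|) C0) => Q /CP PQ maxQ.
exists Q => // X [sQ sX [f isoF]]; apply: maxQ; apply/CP; split=> //.
by case: PQ => _ _ [g isog]; exists (f \o g); apply: iso_in_trans isog isoF.
Qed.

(** Downward induction on |P|. Both [P] and its image [R] map isomorphically to one fully normalized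
    [Q], by [h] and by [h] after the inverse of [f]. Both maps extend to [S], and [f] is the first
    followed by the inverse of the second. *)
Theorem resistance_criterion : normalizer_eq F.
Proof.
suff ext P f : P \subset S -> F P S f -> extends_to_S P f.
  move=> Q Q' f sQ sQ' Ff; apply: ext => //.
  by apply: (@fhom_comp _ _ F Q Q' S f id) => //; apply: fhom_id.
move En: (#|S| - #|P|)%N => n; elim/ltn_ind: n => n IHn in P f En *.
move=> sPS Ff; have [prP | ] := boolP (P \proper S); last first.
  rewrite properE sPS negbK => sSP.
  have defP : P = S by apply: val_inj; apply/eqP; rewrite eqEsubset sPS.
  move: Ff; rewrite defP => Ff; have [fM fI fS] := fhom_inj (subxx S) (subxx S) Ff.
  pose fm := Morphism fM.
  have injf : 'injm fm by apply/injmP.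
  have imf : fm @* S = S.
    apply/(morphim_fixP injf); rewrite // morphimEdom.
    by apply/subsetP=> _ /imsetP[x Sx ->]; apply: fS.
  exists (aut injf imf) => [|x Sx]; last by rewrite autE.
  apply/AutFP; split; first exact: Aut_aut.
  by rewrite (@fhom_ext _ _ F _ _ _ f) // => x Sx; rewrite autE.
have [Q [_ sQS [h isoh]] fnQ] := fully_normalized_exists sPS.
have oQ := iso_in_card sPS sQS isoh.
have IH R g : (#|Q| < #|R|)%N -> R \subset S -> F R S g -> extends_to_S R g.
  move=> ltQR sRS; apply: IHn (erefl _) sRS; rewrite -En.
  by rewrite ltn_sub2l -?oQ // oQ proper_card.
have prQ : Q \proper S by rewrite properEcard sQS oQ proper_card.
have [R [sRS imR isoR]] := fhom_iso sPS (subxx S) Ff.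
have [f' [isof' fK f'K]] := iso_in_sym isoR.
have isoRQ : iso_in F R Q (h \o f') by apply: iso_in_trans isof' isoh.
have [chi Achi chiE] := extend_to_fully_normalized prQ fnQ sPS isoh IH.
have [psi Apsi psiE] := extend_to_fully_normalized prQ fnQ sRS isoRQ IH.
pose GS := Group (AutF_group_set (subxx S)).
exists (chi * psi^-1) => [|x Px].
  by rewrite (groupM (G := GS)) // (groupVr (G := GS)).
have Rfx : f x \in R by rewrite -imR imset_f.
rewrite permM chiE // -[h x](congr1 h (fK x Px)) -[h (f' _)]/((h \o f') (f x)).
by rewrite -psiE // permK.
Qed.

End Criterion.

End Fusion.

(** * Automorphisms stabilizing a chain *)

Section Chains.

Variable gT : finGroupType.
Implicit Types (P K M H L : {group gT}) (B T : {group {perm gT}}).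

Definition stable_under (B : {set {perm gT}}) (H : {set gT}) :=
  forall a, a \in B -> {in H, forall x, a x \in H}.

Lemma AutM P a : a \in Aut P -> {in P &, {morph a : x y / x * y}}.
Proof. by move=> Aa x y; apply: (morphM (autm_morphism Aa)). Qed.

Lemma AutX P a n : a \in Aut P -> {in P, {morph a : x / x ^+ n}}.
Proof. by move=> Aa x; apply: (morphX (autm_morphism Aa)). Qed.

Lemma AutV P a : a \in Aut P -> {in P, {morph a : x / x^-1}}.
Proof. by move=> Aa x; apply: (morphV (autm_morphism Aa)). Qed.

Lemma coset_mulr L x k : x \in 'N(L) -> k \in L -> coset L (x * k) = coset L x.
Proof.
move=> Nx Lk; have Nk := subsetP (normG L) k Lk.
by rewrite morphM //= [coset L k]coset_id // mulg1.
Qed.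

Lemma AutR P a : a \in Aut P -> {in P &, {morph a : x y / [~ x, y]}}.
Proof. by move=> Aa x y; apply: (morphR (autm_morphism Aa)). Qed.

Lemma Aut_morph1 P a : a \in Aut P -> a 1 = 1.
Proof. by move=> Aa; apply: (morph1 (autm_morphism Aa)). Qed.

(** An endomorphism of a cyclic group is a power map, with exponent read off from a generator. *)
Lemma cyclic_section_power P H L B a : B \subset Aut P -> H \subset P ->
    stable_under B H -> stable_under B L -> L <| H -> cyclic (H / L) -> a \in B ->
  exists i, {in H, forall x, coset L (a x) = coset L x ^+ i}.
Proof.
move=> sBA sHP BH BL /andP[sLH nLH] /cyclicP[Y defY] Ba.
have Aa := subsetP sBA a Ba.
have: Y \in H / L by rewrite defY cycle_id.
case/morphimP=> y Ny Hy Dy; rewrite Dy in defY.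
have: coset L (a y) \in H / L by rewrite mem_quotient ?BH.
rewrite defY => /cycleP[i Di]; exists i => x Hx.
have: coset L x \in H / L by rewrite mem_quotient.
rewrite defY => /cycleP[n Dn].
have Nx : x \in 'N(L) by apply: (subsetP nLH).
have: (y ^+ n)^-1 * x \in L.
  apply: coset_idr; first by rewrite groupM ?groupV ?groupX.
  by rewrite morphM ?morphV ?morphX ?groupV ?groupX //= Dn mulVg. 
move: (_ * x) (mulKVg (y ^+ n) x) => k <- Lk {Nx Dn}.
have Hk : k \in H by apply: (subsetP sLH).
have Hyn : y ^+ n \in H by rewrite groupX.
rewrite (AutM Aa) ?(subsetP sHP) // (AutX _ Aa) ?(subsetP sHP) //.
rewrite !coset_mulr ?BL ?(subsetP nLH) ?groupX ?BH // !morphX ?(subsetP nLH) ?BH //= Di.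
by rewrite -!expgM mulnC.
Qed.

(** Power maps of a cyclic group commute, so commutators of elements of [B] act trivially on H /
    L. *)
Lemma der1_cyclic_section P H L B u : B \subset Aut P -> H \subset P ->
    stable_under B H -> stable_under B L -> L <| H -> cyclic (H / L) ->
  u \in B^`(1) -> {in H, forall x, x^-1 * u x \in L}.
Proof.
move=> sBA sHP BH BL nLH cycHL; have [sLH nLHs] := andP nLH.
pose U := [set u in B | [forall x in H, x^-1 * u x \in L]].
have gU : group_set U.
  apply/group_setP.
  split=> [|v w /setIdP[Bv /forall_inP Hv] /setIdP[Bw /forall_inP Hw]].
    by rewrite inE group1; apply/forall_inP=> x _; rewrite perm1 mulVg.
  rewrite inE groupM //; apply/forall_inP=> x Hx.
  have -> : x^-1 * (v * w) x = x^-1 * v x * ((v x)^-1 * w (v x)).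
    by rewrite permM -mulgA mulKVg.
  by rewrite groupM ?Hv ?Hw ?BH.
suff sU : B^`(1) \subset Group gU.
  by move/(subsetP sU)/setIdP=> [_ /forall_inP].
rewrite gen_subG; apply/subsetP=> _ /imset2P[a b Ba Bb ->].
rewrite inE groupR //; apply/forall_inP=> x Hx.
have [i ai] := cyclic_section_power sBA sHP BH BL nLH cycHL Ba.
have [j bj] := cyclic_section_power sBA sHP BH BL nLH cycHL Bb.
pose w := (b * a)^-1 x.
have Hw : w \in H by rewrite BH // groupV groupM.
have def_x : x = (b * a) w by rewrite permKV.
have Hux : [~ a, b] x \in H by rewrite BH ?groupR.
have Nx : x \in 'N(L) by apply: (subsetP nLHs).
have Nux : [~ a, b] x \in 'N(L) by apply: (subsetP nLHs).
apply: coset_idr; first by rewrite groupM ?groupV.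
suff e : coset L ([~ a, b] x) = coset L x.
  by rewrite morphM ?groupV // morphV //= e mulVg.
rewrite {1}def_x -permM -commgC def_x !permM.
have aw : a w \in H by apply: BH.
have bw : b w \in H by apply: BH.
by rewrite bj ?ai ?bj -?expgM 1?mulnC. 
Qed.

Lemma stable_step P H L u : u \in Aut P -> H \subset P -> L \subset P ->
    {in L, u =1 id} -> {in H, forall x, x^-1 * u x \in L} ->
  {in H, u ^+ #|L| =1 id}.
Proof.
move=> Au sHP sLP uL uH x Hx.
have un n : (u ^+ n) x = x * (x^-1 * u x) ^+ n.
  elim: n => [|n IHn]; first by rewrite perm1 mulg1.
  have Ln : (x^-1 * u x) ^+ n \in L by rewrite groupX ?uH.
  rewrite expgSr permM IHn (AutM Au) ?(subsetP sLP _ Ln) ?(subsetP sHP) //.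
  by rewrite (uL _ Ln) expgS !mulgA mulgV mul1g.
by rewrite un expg_cardG ?uH // mulg1.
Qed.

(** The derived subgroup of [B] acts trivially on each factor of 1 <= K <= M <= P. By [stable_step]
    its elements have order dividing |K| |M|, so it is a p-group. It thus lies in the p-core of [B],
    hence in [T], and a subgroup containing the derived subgroup is normal. *)
Lemma chain_Sylow_normal (p : nat) P M K B T : p.-group P -> B \subset Aut P ->
    M <| P -> K <| M -> stable_under B M -> stable_under B K ->
    cyclic K -> cyclic (M / K) -> cyclic (P / M) -> p.-Sylow(B) T ->
  T <| B.
Proof.
move=> pP sBA nMP nKM BM BK cK cMK cPM sylT.
have [[sMP _] [sKM _]] := (andP nMP, andP nKM); have sKP := subset_trans sKM sMP.
have BP : stable_under B P by move=> a /(subsetP sBA) Aa x; apply: Aut_closed.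
have B1 : stable_under B 1%G.
  move=> a Ba _ /set1P->; apply/set1P.
  by apply: (morph1 (autm_morphism (subsetP sBA a Ba))).
have cK1 : cyclic (K / 1) by rewrite quotient_cyclic.
have pB' : p.-group B^`(1).
  apply/pgroupP=> q pr_q /(Cauchy pr_q)[u B'u oq].
  have Bu : u \in B by apply: (subsetP (der_sub 1 B)).
  have Au := subsetP sBA u Bu.
  have uK : {in K, u =1 id}.
    move=> x Kx; have := der1_cyclic_section sBA sKP BK B1 (normal1 K) cK1 B'u Kx.
    by move/set1P/(canRL (mulKVg _)); rewrite mulg1.
  have uM := der1_cyclic_section sBA sMP BM BK nKM cMK B'u.
  have uP := der1_cyclic_section sBA (subxx P) BP BM nMP cPM B'u.
  have uM1 := stable_step Au sMP sKP uK uM.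
  have uP1 : {in P, u ^+ (#|K| * #|M|) =1 id}.
    have BuK : u ^+ #|K| \in B^`(1) by rewrite groupX.
    rewrite expgM; apply: (@stable_step P) => //; first by rewrite groupX.
    exact: (der1_cyclic_section sBA _ BP BM nMP cPM).
  have u1 : u ^+ (#|K| * #|M|) = 1.
    by apply: (eq_Aut (groupX _ Au) (group1 _)) => x Px; rewrite uP1 ?perm1.
  have := pgroupP (G := P) pP q pr_q; apply.
  have: q %| #|K| * #|M| by rewrite -oq order_dvdn u1.
  by rewrite Euclid_dvdM // => /orP[] /dvdn_trans-> //; apply: cardSg.
have [sTB _ _] := and3P sylT.
rewrite sub_der1_normal // (subset_trans (pcore_max pB' (der_normal 1 B))) //.
exact: pcore_sub_Hall.
Qed.

Lemma cyclic_mul_quotient (x : gT) H L : H \subset 'N(L) -> <[x]> * L = H ->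
  cyclic (H / L).
Proof.
move=> nLH defH.
have Nx : x \in 'N(L).
  by rewrite (subsetP nLH) // -defH (subsetP (mulG_subl _ _)) ?cycle_id.
by rewrite -defH quotientMidr quotient_cycle // cycle_cyclic.
Qed.

Lemma stable_cycle P x B : B \subset Aut P -> x \in P ->
  (forall a, a \in B -> a x \in <[x]>) -> stable_under B <[x]>.
Proof.
move=> sBA Px Bx a Ba _ /cycleP[i ->].
by rewrite (AutX _ (subsetP sBA a Ba)) // groupX ?Bx.
Qed.

(** The chain is characteristic: [M] consists of the elements killed by p^(m+1), and [K] of the p-th
    powers. The exponent m + 2 keeps [P] from being elementary abelian of order p^2, where GL_2(p)
    would be a counterexample. *)
Lemma abelian_Sylow_normal (p m : nat) P (u x : gT) B T : prime p ->
    abelian P -> <[u]> * <[x]> = P -> u ^+ p = 1 -> #[x] = (p ^ m.+2)%N ->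
    B \subset Aut P -> p.-Sylow(B) T -> T <| B.
Proof.
move=> pr_p cPP defP up1 ox sBA sylT.
have p_gt0 := prime_gt0 pr_p.
have Pu : u \in P by rewrite -defP (subsetP (mulG_subl _ _)) ?cycle_id.
have Px : x \in P by rewrite -defP (subsetP (mulG_subr _ _)) ?cycle_id.
have cP y z : y \in P -> z \in P -> commute y z by move=> Py; apply: (centsP cPP).
pose K := <[x ^+ p]>%G.
have sKP : K \subset P by rewrite cycle_subG groupX.
have sUP : <[u]> \subset P by rewrite cycle_subG.
pose M := (<[u]> <*> K)%G.
have defM : M :=: <[u]> * K by rewrite /= cent_joinEr // (centSS _ _ cPP).
have sMP : M \subset P by rewrite join_subG sUP.
have inM y : (y \in M) = (y \in P) && (y ^+ (p ^ m.+1) == 1).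
  apply/idP/andP=> [My | [Py /eqP yp]].
    split; first exact: (subsetP sMP).
    move: My; rewrite defM => /mulsgP[_ _ /cycleP[i ->] /cycleP[j ->] ->].
    rewrite expgMn; last by apply: cP; rewrite !groupX.
    rewrite expnS -2!expgM mulnCA expgM up1 expg1n mul1g.
    by rewrite -!expgM mulnCA -!expnS mulnC expgM -ox expg_order expg1n.
  move: Py yp; rewrite -defP => /mulsgP[_ _ /cycleP[i ->] /cycleP[j ->] ->].
  rewrite expgMn; last by apply: cP; rewrite !groupX.
  rewrite -!expgM {1}expnS mulnCA expgM up1 expg1n mul1g => /eqP.
  rewrite -order_dvdn ox expnS dvdn_pmul2r ?expn_gt0 ?p_gt0 // => /dvdnP[k ->].
  by rewrite defM mem_mulg ?mem_cycle // mulnC expgM mem_cycle.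
have pP : p.-group P.
  have pu : p.-group <[u]>.
    by apply: (@pnat_dvd _ p); rewrite ?pnat_id // order_dvdn up1.
  have px : p.-group <[x]> by rewrite /pgroup -orderE ox pnatX pnat_id.
  by rewrite -defP pgroupM pu.
have PB a : a \in B -> {in P, forall y, a y \in P}.
  by move/(subsetP sBA) => Aa y; apply: Aut_closed.
apply: (@chain_Sylow_normal p P M K B T) => //.
- by rewrite -sub_abelian_normal.
- by rewrite -sub_abelian_normal ?joing_subr // (abelianS sMP).
- move=> a Ba y; rewrite !inM => /andP[Py /eqP yp1]; rewrite PB //=.
  have Aa := subsetP sBA a Ba.
  by rewrite -(AutX _ Aa) // yp1 -(autmE Aa) morph1.
- apply: (@stable_cycle P) => // [|a Ba]; first exact: groupX.
  rewrite (AutX _ (subsetP sBA a Ba)) //; move: (PB a Ba x Px).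
  rewrite -{1}defP => /mulsgP[_ _ /cycleP[i ->] /cycleP[j ->] ->].
  rewrite expgMn; last by apply: cP; rewrite !groupX.
  by rewrite -!expgM mulnC expgM up1 expg1n mul1g mulnC expgM mem_cycle.
- exact: cycle_cyclic.
- apply: (@cyclic_mul_quotient u); last by rewrite -defM.
  by rewrite cents_norm // (centSS _ _ cPP).
apply: (@cyclic_mul_quotient x); first by rewrite cents_norm // (centSS _ _ cPP).
apply/eqP; rewrite eqEsubset mul_subG ?cycle_subG //= -defP.
rewrite normC ?cents_norm ?(centSS _ _ cPP) ?cycle_subG //.
by rewrite mulgS // joing_subl.
Qed.

End Chains.

(** * Two transvections with different axes *)

Lemma prime_modular_inverse p v : prime p -> ~~ (p %| v) ->
  exists j s, (v * j = p * s + 1)%N.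
Proof.
move=> pr_p pv; have v_gt0 : (0 < v)%N by case: v pv; rewrite ?dvdn0.
case: (egcdnP p v_gt0) => j s def_j _; exists j, s.
by rewrite mulnC def_j mulnC (eqP (_ : coprime v p)) // coprime_sym prime_coprime.
Qed.

Section MovedSection.

Variables (gT : finGroupType) (p : nat) (P K M : {group gT}).
Variables (G : {group {perm gT}}) (t : {perm gT}).
Hypotheses (pr_p : prime p) (sGA : G \subset Aut P).
Hypotheses (sKM : K \subset M) (sMP : M \subset P) (nKP : P \subset 'N(K)).
Hypotheses (cPK : abelian (P / K)) (oMK : #|M : K| = p).
Hypotheses (GK : stable_under G K) (Gt : t \in G).
(** With [tP], this says that [t] acts on P / K as a transvection with axis M / K. *)
Hypothesis tM : {in M, forall y, y^-1 * t y \in K}.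
Hypothesis tP : {in P, forall y, y \notin M -> y^-1 * t y \in M :\: K}.

Let GP a : a \in G -> {in P, forall x, a x \in P}.
Proof. by move/(subsetP sGA) => Aa x; apply: Aut_closed. Qed.

Let cosetM x y : x \in P -> y \in P -> coset K (x * y) = coset K x * coset K y.
Proof. by move=> Px Py; rewrite morphM ?(subsetP nKP). Qed.

Let cosetX x n : x \in P -> coset K (x ^+ n) = coset K x ^+ n.
Proof. by move=> Px; rewrite morphX ?(subsetP nKP). Qed.

Let cosetV x : x \in P -> coset K x^-1 = (coset K x)^-1.
Proof. by move=> Px; rewrite morphV ?(subsetP nKP). Qed.

Let coset_eq_mem x y : x \in P -> y \in P -> coset K x = coset K y -> x^-1 * y \in K.
Proof.
move=> Px Py e; apply: coset_idr; first by rewrite (subsetP nKP) ?groupM ?groupV.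
by rewrite cosetM ?groupV // cosetV // e mulVg.
Qed.

Let mem_coset_eq1 x : x \in P -> (coset K x == 1) = (x \in K).
Proof.
move=> Px; apply/eqP/idP => [|Kx]; last exact: coset_id.
by apply: coset_idr; rewrite (subsetP nKP).
Qed.

Let coset_congr a x y : a \in G -> x \in P -> y \in P ->
  coset K x = coset K y -> coset K (a x) = coset K (a y).
Proof.
move=> Ga Px Py exy; have Aa := subsetP sGA a Ga.
have Kxy : x^-1 * y \in K by apply: coset_eq_mem.
rewrite -(mulKVg x y) (AutM Aa) ?groupM ?groupV //.
by rewrite coset_mulr ?(GK Ga) ?(subsetP nKP) ?GP.
Qed.

Let commPK x y : x \in P -> y \in P -> commute (coset K x) (coset K y).
Proof. by move=> Px Py; apply: (centsP cPK); apply: mem_quotient. Qed.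

Let gen_MK x : x \in M -> x \notin K ->
  {in M, forall y, exists i, coset K y = coset K x ^+ i}.
Proof.
move=> Mx Kx y My.
have oq : #|M / K| = p.
  by rewrite card_quotient // (subset_trans sMP).
have: coset K y \in <[coset K x]>.
  have -> : <[coset K x]> = M / K; last exact: mem_quotient.
  apply/eqP; rewrite eqEcard cycle_subG mem_quotient //= oq -orderE.
  rewrite dvdn_leq // -(@nt_prime_order _ p (coset K x)) //.
    by apply/eqP; rewrite -order_dvdn -oq order_dvdG ?mem_quotient.
  by rewrite mem_coset_eq1 // (subsetP sMP).
by case/cycleP=> i ->; exists i.
Qed.

Let expMK x : x \in M -> coset K x ^+ p = 1.
Proof.
move=> Mx; apply/eqP; rewrite -order_dvdn -oMK -card_quotient ?(subset_trans sMP) //.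
by rewrite order_dvdG ?mem_quotient.
Qed.

Let shear f l m v := [/\ f \in G, coset K (f l) = coset K l * coset K m ^+ v
                       & coset K (f m) = coset K m].

Let shearX f l m v n : l \in P -> m \in P -> shear f l m v ->
  shear (f ^+ n) l m (v * n).
Proof.
move=> Pl Pm [Gf fl fm]; split; first exact: groupX.
  elim: n => [|n IHn]; first by rewrite perm1 muln0 mulg1.
  have Gfn : f ^+ n \in G by apply: groupX.
  rewrite expgSr permM (@coset_congr _ _ (l * m ^+ (v * n))) ?groupM ?groupX ?GP //.
    rewrite (AutM (subsetP sGA f Gf)) ?groupX // (AutX _ (subsetP sGA f Gf)) //.
    by rewrite cosetM ?groupX ?GP // cosetX ?GP // fl fm -mulgA -expgD mulnS.
  by rewrite IHn cosetM ?groupX // cosetX.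
elim: n => [|n IHn]; first by rewrite perm1.
by rewrite expgSr permM (@coset_congr _ _ m) // GP // groupX.
Qed.

(** If [g] moves [M], the conjugate of [t] by [g] is a transvection with a different axis, spanned
    by [m]. In the basis [l], [m] of P / K both are elementary matrices, and a product of three of
    them is triangular with diagonal 2 and w + 1 = 1/2. *)
Lemma moved_section w : p = w.*2.+1 -> ~ stable_under G M ->
  exists a m, [/\ a \in G, stable_under [set a] M, m \in P, m \notin M
    & (m ^+ w.+1)^-1 * a m \in M].
Proof.
move=> def_p notGM.
have [g Gg [y0 My0 gy0]] : exists2 g, g \in G & exists2 y, y \in M & g y \notin M.
  case: (boolP [exists g in G, exists y in M, g y \notin M]).
    by case/exists_inP=> g Gg /exists_inP[y My gy]; exists g => //; exists y.
  rewrite negb_exists_in => /forall_inP GM; case: notGM => a Ga y My.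
  by have /exists_inPn/(_ y My) := GM a Ga; rewrite negbK.
have Ag := subsetP sGA g Gg; have Py0 := subsetP sMP y0 My0.
have GgV : g^-1 \in G by rewrite groupV.
have Agv := subsetP sGA _ GgV.
have Ky0 : y0 \notin K.
  by apply: contra gy0 => Ky0; rewrite (subsetP sKM) // (GK Gg).
pose m := g y0; have Pm : m \in P by rewrite GP.
pose l := m^-1 * t m.
have /setDP[Ml Kl] : l \in M :\: K by apply: tP.
have Pl := subsetP sMP l Ml.
have gM x : x \in M -> exists i, coset K (g x) = coset K m ^+ i.
  move=> Mx; have [i xi] := gen_MK My0 Ky0 Mx; exists i.
  rewrite (@coset_congr _ _ (y0 ^+ i)) ?groupX ?(subsetP sMP) //.
    by rewrite (AutX _ Ag) // cosetX.
  by rewrite xi cosetX.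
have Km : m \notin K by apply: contra gy0; apply: (subsetP sKM).
have mp : coset K m ^+ p = 1.
  rewrite -cosetX // -(AutX _ Ag) //; apply/coset_id/(GK Gg).
  by rewrite -mem_coset_eq1 ?groupX // cosetX // expMK.
have mM v : coset K (m ^+ v) \in M / K -> p %| v.
  move=> Mv; apply: contraR gy0 => /(prime_modular_inverse pr_p)[j [s vj]].
  have: coset K m \in M / K.
    rewrite -[coset K m]mul1g -(expg1n _ s) -mp -expgM -expgSr -addn1 -vj expgM.
    by rewrite groupX // -cosetX.
  case/morphimP=> x Nx Mx /= mx.
  rewrite -[g y0](mulKVg x) groupM // (subsetP sKM) //.
  by apply: coset_eq_mem => //; apply: (subsetP sMP).
pose f := g^-1 * t * g.
have Gf : f \in G by rewrite !groupM.
have fE y : y \in P -> f y = y * g ((g^-1 y)^-1 * t (g^-1 y)).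
  move=> Py; rewrite (AutM Ag) ?groupV ?GP // (AutV Ag) ?GP // permKV.
  by rewrite mulKVg !permM.
have fm : coset K (f m) = coset K m.
  rewrite fE // coset_mulr ?(subsetP nKP) // (GK Gg) // /m permK.
  exact: tM.
have [v fl] : exists v, coset K (f l) = coset K l * coset K m ^+ v.
  have Mz : (g^-1 l)^-1 * t (g^-1 l) \in M.
    have [Mgl | /tP] := boolP (g^-1 l \in M); first by rewrite (subsetP sKM) ?tM.
    by rewrite GP // => /(_ isT)/setDP[].
  have [v gv] := gM _ Mz; exists v.
  by rewrite fE // cosetM ?GP ?(subsetP sMP _ Mz) // gv.
(* If [f] fixed [l] modulo [K], then g^-1 l would lie in the axis [M] of [t], and [l] would be a
   power of [m] modulo [K]; as [l] is in [M] and [m] is not, [l] would lie in [K]. *)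
have pv : ~~ (p %| v).
  apply: contra Kl => /dvdnP[v' def_v].
  have glM : g^-1 l \in M.
    apply: contraT => glM; have := tP _ glM; rewrite GP // => /(_ isT)/setDP[Mz Kz].
    case/negP: Kz; rewrite -[_ * _](permK g) (GK GgV) //.
    rewrite -mem_coset_eq1 ?GP ?(subsetP sMP _ Mz) //.
    apply/eqP/(mulgI (coset K l)); rewrite -cosetM ?GP ?(subsetP sMP _ Mz) //.
    by rewrite -fE // fl def_v mulnC expgM mp expg1n.
  have [i] := gM _ glM; rewrite permKV => li.
  have /dvdnP[i' def_i] : p %| i by rewrite mM // cosetX // -li mem_quotient.
  by rewrite -mem_coset_eq1 // li def_i mulnC expgM mp expg1n.
have [j [s vj]] := prime_modular_inverse pr_p pv.
have shf : shear f l m v by [].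
have sh1 : shear (f ^+ j) l m 1.
  have [? e ?] := shearX j Pl Pm shf; split=> //.
  by rewrite e vj expgD expgM mp expg1n mul1g.
have [] := sh1; move: (f ^+ j) sh1 => f1 sh1 Gf1 f1l f1m.
have [] := shearX w Pl Pm sh1; move: (f1 ^+ w) => f2; rewrite mul1n => Gf2 f2l f2m.
have tm : t m = m * l by rewrite mulKVg.
have tl : coset K (t l) = coset K l.
  by rewrite -[t l](mulKVg l) coset_mulr ?(subsetP nKP) // tM.
have [At Af1] := (subsetP sGA t Gt, subsetP sGA f1 Gf1).
have Af2 := subsetP sGA f2 Gf2.
have nMm : m \notin M := gy0.
clearbody l m.
have clm := commPK Pl Pm.
(* Permutations compose from left to right. Modulo [K]: l -> l m -> l^2 m -> l^2 m^(2w+1) = l^2, and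
   m -> m -> m l -> m^(w+1) l. *)
pose a := f1 * t * f2; have Ga : a \in G by rewrite !groupM.
have al : coset K (a l) = coset K l ^+ 2.
  have e1 : coset K (t (f1 l)) = coset K (l * m * l).
    have e : coset K (f1 l) = coset K (l * m) by rewrite f1l expg1 cosetM.
    rewrite (coset_congr Gt _ _ e) ?GP ?groupM //.
    by rewrite (AutM At) // !cosetM ?GP ?groupM // tl tm cosetM // mulgA.
  rewrite !permM (coset_congr Gf2 _ _ e1) ?GP ?groupM //.
  rewrite !(AutM Af2) ?groupM // !cosetM ?groupM ?GP // f2l f2m.
  move: (coset K l) (coset K m) clm mp => X Y cXY Yp.
  have cYZ : commute Y (X * Y ^+ w).
    by apply: commuteM; [apply: commute_sym | apply: commuteX].
  rewrite -mulgA cYZ mulgA -expg2 expgMn; last exact: commuteX.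
  by rewrite -mulgA -expgM muln2 -expgSr -def_p Yp mulg1.
have am : coset K (a m) = coset K m ^+ w.+1 * coset K l.
  have e1 : coset K (t (f1 m)) = coset K (m * l).
    by rewrite (coset_congr Gt _ _ f1m) ?GP // tm.
  rewrite !permM (coset_congr Gf2 _ _ e1) ?GP ?groupM //.
  rewrite (AutM Af2) // cosetM ?GP // f2l f2m.
  have cwl : commute (coset K l) (coset K m ^+ w) by apply: commuteX.
  by rewrite cwl mulgA -expgS.
exists a, m; split=> //.
  move=> _ /set1P-> y My; have Py := subsetP sMP y My.
  have [i yi] := gen_MK Ml Kl My.
  have e : coset K (a y) = coset K (l ^+ (2 * i)).
    rewrite (@coset_congr a _ (l ^+ i)) ?groupX // ?yi ?cosetX //.
    by rewrite (AutX _ (subsetP sGA a Ga)) // cosetX ?GP // al expgM.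
  rewrite -[a y](mulKVg (l ^+ (2 * i))) groupM ?groupX // (subsetP sKM) //.
  by apply: coset_eq_mem; rewrite ?groupX ?GP.
have Kam : (m ^+ w.+1 * l)^-1 * a m \in K.
  by apply: coset_eq_mem; rewrite ?groupM ?groupX ?GP // am cosetM ?groupX ?cosetX.
rewrite -(groupMl _ (groupVr Ml)) mulgA -invMg.
exact: (subsetP sKM).
Qed.

End MovedSection.

(** * The structure of G(p, r; e) *)

(** Maximality of subgroups of prime index. Below, it turns a single element outside [H] into an
    equality with [G]. *)
Lemma prime_index_eq (gT : finGroupType) (H L G : {group gT}) :
  prime #|G : H| -> H \subset L -> L \subset G -> ~~ (L \subset H) -> L :=: G.
Proof.
move=> pr_i sHL sLG nLH; apply/eqP; rewrite eqEsubset sLG -indexg_eq1 /=.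
have := Lagrange_index sLG sHL; move: nLH; rewrite -indexg_eq1 => /negPf nLH e.
move: pr_i; rewrite -e => /primeP[_ /(_ #|L : H|)].
rewrite dvdn_mull // nLH /= => /(_ isT)/eqP.
by rewrite -{1}[#|L : H|]mul1n => /eqP; rewrite eqn_pmul2r ?indexg_gt0 // eq_sym.
Qed.

Lemma commg_gen_sub (gT : finGroupType) (X Y : {set gT}) (K : {group gT}) :
    X \subset 'N(K) -> Y \subset 'N(K) -> {in X & Y, forall x y, [~ x, y] \in K} ->
  [~: <<X>>, <<Y>>] \subset K.
Proof.
move=> nXK nYK XY; rewrite -quotient_cents2 ?gen_subG // !quotient_gen //.
rewrite cent_gen gen_subG quotient_cents2 // gen_subG.
by apply/subsetP=> _ /imset2P[x y Xx Yy ->]; apply: XY.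
Qed.

Lemma commute_comm1 (gT : finGroupType) (x y : gT) : commute x y -> [~ x, y] = 1.
Proof. by move/commgP/eqP. Qed.

Section Structure.

Variables (gT : finGroupType) (p k e : nat) (a b c : gT).
Hypotheses (pr_p : prime p) (k_gt0 : (0 < k)%N) (ndiv_pe : ~~ (p %| e)).
Hypotheses (ap1 : a ^+ p = 1) (bp1 : b ^+ p = 1) (oc : #[c] = (p ^ k.+1)%N).
Hypotheses (rel_bc : [~ b, c] = 1) (rel_ab : [~ a, b^-1] = c ^+ (e * p ^ k)).
Hypothesis rel_ac : [~ a, c] = b.
Let S := <<[set a; b; c]>>%G.
Let A := <<[set b; c]>>%G.
Let Z := <[c ^+ p]>%G.
Let D := <<[set b; c ^+ p]>>%G.
Let Z0 := <[c ^+ (p ^ k)]>%G.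
Hypotheses (nbc : b \notin <[c]>) (nAa : a \notin A).

Let p_gt0 : (0 < p)%N := prime_gt0 pr_p.
Let p_gt1 : (1 < p)%N := prime_gt1 pr_p.

Let Sa : a \in S. Proof. by rewrite mem_gen // !inE eqxx. Qed.
Let Sb : b \in S. Proof. by rewrite mem_gen // !inE eqxx orbT. Qed.
Let Sc : c \in S. Proof. by rewrite mem_gen // !inE eqxx orbT. Qed.
Let Ab : b \in A. Proof. by rewrite mem_gen // !inE eqxx. Qed.
Let Ac : c \in A. Proof. by rewrite mem_gen // !inE eqxx orbT. Qed.
Let Db : b \in D. Proof. by rewrite mem_gen // !inE eqxx. Qed.

Let commute_bc : commute b c. Proof. by apply/commgP/eqP. Qed.

Let cAA : abelian A.
Proof.
rewrite /abelian cent_gen gen_subG; apply/subsetP=> x; rewrite !inE => xA.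
apply/centP=> y; rewrite !inE => yA.
by case/orP: xA => /eqP->; case/orP: yA => /eqP->.
Qed.

Let sAS : A \subset S.
Proof. by rewrite gen_subG; apply/subsetP=> x; rewrite !inE => /orP[] /eqP->. Qed.

Let sDA : D \subset A.
Proof.
rewrite gen_subG; apply/subsetP=> x; rewrite !inE => /orP[] /eqP-> //.
by rewrite groupX.
Qed.

Let sZD : Z \subset D.
Proof. by rewrite cycle_subG mem_gen // !inE eqxx orbT. Qed.

Let sZ0Z : Z0 \subset Z.
Proof. by rewrite cycle_subG -(prednK k_gt0) expnS expgM mem_cycle. Qed.

Let sDS : D \subset S := subset_trans sDA sAS.
Let sZS : Z \subset S := subset_trans sZD sDS.
Let sZA : Z \subset A := subset_trans sZD sDA.

Let c_conj_a : c ^ a = c * b^-1.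
Proof. by rewrite -rel_ac commgEr conjVg invMg invgK mulKVg. Qed.

Let cent_pow x n : x \in A -> commute a (x ^+ n) -> x ^+ n \in 'Z(S).
Proof.
move=> Ax cax; apply/setIP; split; first by rewrite groupX ?(subsetP sAS).
rewrite cent_gen; apply/centP=> y; rewrite !inE => /orP[/orP[]|] /eqP-> //.
  by apply: (centsP cAA); rewrite ?groupX.
by apply: (centsP cAA); rewrite ?groupX.
Qed.

Let sZcent : Z \subset 'Z(S).
Proof.
rewrite cycle_subG cent_pow //; apply: commute_sym; apply/commgP/conjg_fixP.
rewrite conjXg c_conj_a expgMn ?expgVn ?bp1 ?invg1 ?mulg1 //.
by apply: commuteV; apply: commute_sym.
Qed.

Let cZ y x : y \in Z -> x \in S -> commute x y.
Proof.
move=> Zy Sx; apply: commute_sym; apply: (centP _ x Sx).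
exact: (subsetP (subset_trans sZcent (subsetIr _ _))).
Qed.

Let normZ (H : {group gT}) : H \subset Z -> S \subset 'N(H).
Proof.
move=> sHZ; apply: cents_norm; rewrite centsC (subset_trans sHZ) //.
exact: subset_trans sZcent (subsetIr _ _).
Qed.

Let nZS : S \subset 'N(Z). Proof. exact: normZ. Qed.
Let nZ0S : S \subset 'N(Z0). Proof. exact: normZ. Qed.

Let Z0_ab : [~ a, b] \in Z0.
Proof.
have ba : b ^ a = c ^+ (e * p ^ k) * b.
  by rewrite -rel_ab commgEr invgK mulgKV.
have Zz : c ^+ (e * p ^ k) \in Z0 by rewrite mulnC expgM mem_cycle.
rewrite commgEr conjVg ba invMg -mulgA -conjgE memJ_norm ?groupV //.
exact: (subsetP nZ0S).
Qed.

Let commSD : [~: S, D] \subset Z0.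
Proof.
have [nS nD] : S \subset 'N(Z0) /\ D \subset 'N(Z0) by rewrite nZ0S (subset_trans sDS).
apply: commg_gen_sub.
- exact: subset_trans (subset_gen _) nS.
- exact: subset_trans (subset_gen _) nD.
move=> x y Xx; have Sx : x \in S by apply: mem_gen.
rewrite !inE => /orP[]/eqP->; last first.
  by rewrite commute_comm1 ?group1 //; apply: cZ Sx; apply: cycle_id.
move: Xx; rewrite !inE => /orP[/orP[]|] /eqP-> //; first by rewrite commgg group1.
by rewrite -invgR groupV rel_bc group1.
Qed.

Let sZ0D : Z0 \subset D := subset_trans sZ0Z sZD.

Let nDS : S \subset 'N(D).
Proof. by rewrite -commg_subr (subset_trans commSD). Qed.

Let commSS : [~: S, S] \subset D.
Proof.
apply: commg_gen_sub; try exact: subset_trans (subset_gen _) nDS.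
have Dab : [~ a, b] \in D by rewrite (subsetP sZ0D).
move=> x y; rewrite !inE.
by case/orP=> [/orP[]|] /eqP->; case/orP=> [/orP[]|] /eqP->;
  rewrite ?commgg ?rel_ac ?rel_bc ?group1 // -invgR groupV ?rel_ac ?rel_bc ?group1.
Qed.

Let nAS : S \subset 'N(A).
Proof.
by rewrite -commg_subr (subset_trans (commgS _ sAS)) // (subset_trans commSS).
Qed.

Let ob : #[b] = p.
Proof. by apply: nt_prime_order => //; apply: contra nbc => /eqP->; apply: group1. Qed.

Let defA : <[b]> * <[c]> = A.
Proof.
rewrite -[RHS]/(<<[set b] :|: [set c]>>) -joingE -joing_idl -joing_idr -cent_joinEr //.
by rewrite cycle_subG /= cent_cycle; apply/cent1P; apply: commute_sym.
Qed.

Let defD : <[b]> * Z = D.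
Proof.
rewrite -[RHS]/(<<[set b] :|: [set c ^+ p]>>) -joingE -joing_idl -joing_idr.
rewrite -cent_joinEr //.
by rewrite cycle_subG /= cent_cycle; apply/cent1P/commute_sym/commuteX.
Qed.

Let TIb (H : {group gT}) : b \notin H -> <[b]> :&: H = 1.
Proof. by move=> nHb; rewrite prime_TIg ?cycle_subG // -orderE ob. Qed.

Let nZb : b \notin Z.
Proof. by apply: contra nbc => /cycleP[i ->]; rewrite -expgM mem_cycle. Qed.

Let oZ : #|Z| = (p ^ k)%N.
Proof. by rewrite -orderE orderXdiv oc expnS ?dvdn_mulr // mulKn. Qed.

Let oA : #|A| = (p ^ k.+2)%N.
Proof. by rewrite -defA TI_cardMg ?TIb // -!orderE ob oc -expnS. Qed.

Let oD : #|D| = (p ^ k.+1)%N.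
Proof. by rewrite -defD TI_cardMg ?TIb // -orderE ob oZ -expnS. Qed.

Let iDZ : #|D : Z| = p.
Proof. by rewrite -divgS // oD oZ expnS mulnK // expn_gt0 p_gt0. Qed.

Let iAD : #|A : D| = p.
Proof. by rewrite -divgS // oD oA expnS mulnK // expn_gt0 p_gt0. Qed.

Let oa : #[a] = p.
Proof. by apply: nt_prime_order => //; apply: contra nAa => /eqP->; apply: group1. Qed.

Let defS : <[a]> * A = S.
Proof.
rewrite -norm_joinEl ?cycle_subG ?(subsetP nAS) //.
apply/eqP; rewrite eqEsubset join_subG cycle_subG Sa sAS gen_subG.
apply/subsetP=> x; rewrite !inE -orbA => /or3P[] /eqP->.
- by rewrite (subsetP (joing_subl _ _)) ?cycle_id.
- exact: (subsetP (joing_subr _ _)).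
exact: (subsetP (joing_subr _ _)).
Qed.

Let iSA : #|S : A| = p.
Proof.
rewrite -divgS // -defS TI_cardMg -?orderE ?oa ?mulnK ?cardG_gt0 //.
by rewrite prime_TIg -?orderE ?oa // cycle_subG.
Qed.

Let pS : p.-group S.
Proof.
by rewrite /pgroup -(Lagrange sAS) iSA oA -expnSr pnatX pnat_id.
Qed.

(** The centralizer of [b] contains [A], of prime index. If it were larger, [a] would commute with
    [b], against p not dividing e. *)
Let cent_b x : x \in S -> commute x b -> x \in A.
Proof.
move=> Sx cxb; apply: contraT => nAx.
have sAC : A \subset 'C_S[b] by rewrite subsetI sAS sub_cent1 (subsetP cAA).
have /setP/(_ a) : 'C_S[b] = S.
  apply: (@prime_index_eq _ A); rewrite ?iSA ?subsetIl //.
  by apply: contra nAx => /subsetP->; rewrite // inE Sx; apply/cent1P.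
rewrite Sa inE Sa => /cent1P cab; case/negP: ndiv_pe.
have : c ^+ (e * p ^ k) == 1.
  by rewrite -rel_ab; apply/eqP/commute_comm1/commuteV/commute_sym.
by rewrite -order_dvdn oc expnS dvdn_pmul2r ?expn_gt0 ?p_gt0.
Qed.

Let comm_b x : x \in S -> x \notin A -> [~ x, b] != 1.
Proof. by move=> Sx; apply: contra => /commgP; apply: cent_b. Qed.

Let comm_Z0 x y : x \in S -> y \in D -> [~ x, y] \in Z0.
Proof. by move=> Sx Dy; rewrite (subsetP commSD) ?mem_commg. Qed.

Let comm_D x y : x \in S -> y \in S -> [~ x, y] \in D.
Proof. by move=> Sx Sy; rewrite (subsetP commSS) ?mem_commg. Qed.

(** The elements commuting with [c] modulo [Z] form a subgroup [C] containing [A]. If [x] were in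
    it, it would be [S], but [a, c] = b is not in [Z]. *)
Let comm_c x : x \in S -> x \notin A -> [~ x, c] \in D :\: Z.
Proof.
move=> Sx nAx; rewrite inE comm_D // andbT; apply/negP=> Zxc.
pose C := (S :&: coset Z @*^-1 'C[coset Z c])%G.
have inC y : (y \in C) = (y \in S) && ([~ y, c] \in Z).
  rewrite inE; case Sy: (y \in S) => //=.
  have [Ny Nc] := (subsetP nZS y Sy, subsetP nZS c Sc).
  apply/morphpreP/idP => [[_ /cent1P/commute_comm1 e1] | Zyc].
    by apply: coset_idr; rewrite ?groupR // morphR.
  split=> //; apply/cent1P/commgP; rewrite -morphR //=.
  by apply/eqP/coset_id.
have sAC : A \subset C.
  apply/subsetP=> y Ay; rewrite inC (subsetP sAS) //=.
  by rewrite commute_comm1 //; apply: (centsP cAA).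
have /setP/(_ a) : C :=: S.
  apply: (@prime_index_eq _ A); rewrite ?iSA ?subsetIl //.
  by apply: contra nAx => /subsetP->; rewrite // inC Sx.
by rewrite inC Sa rel_ac (negPf nZb).
Qed.

Let comm_D_nontriv x y :
  x \in S -> x \notin A -> y \in D -> y \notin Z -> [~ x, y] != 1.
Proof.
move=> Sx nAx Dy nZy; apply: contra (comm_b Sx nAx) => /commgP cxy.
have /setP/(_ b) : 'C_D[x] = D.
  apply: (@prime_index_eq _ Z); rewrite ?iDZ ?subsetIl //.
    rewrite subsetI sZD sub_cent1; apply/centP=> z Zz.
    exact: cZ.
  by apply: contra nZy => /subsetP->; rewrite // inE Dy; apply/cent1P.
by rewrite Db inE Db /= => /cent1P cxb; apply/commgP/commute_sym.
Qed.

(** The elements of [A] commuting with [x] modulo [Z] form a subgroup that contains [D], of index p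
    in [A], and misses [c] by [comm_c]. *)
Let comm_A_nontriv x y :
  x \in S -> x \notin A -> y \in A -> y \notin D -> [~ x, y] \notin Z.
Proof.
move=> Sx nAx Ay nDy; have := comm_c Sx nAx; rewrite inE => /andP[nZ _].
apply: contra nZ => Zxy.
pose C := (A :&: coset Z @*^-1 'C[coset Z x])%G.
have inC z : (z \in C) = (z \in A) && ([~ x, z] \in Z).
  rewrite inE; case Az: (z \in A) => //=; have Sz := subsetP sAS z Az.
  have [Nz Nx] := (subsetP nZS z Sz, subsetP nZS x Sx).
  apply/morphpreP/idP => [[_ /cent1P/commute_sym/commute_comm1 e1] | Zxz].
    by apply: coset_idr; rewrite ?groupR // morphR.
  split=> //; apply/cent1P/commute_sym/commgP; rewrite -morphR //=.
  by apply/eqP/coset_id.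
have /setP/(_ c) : C :=: A.
  apply: (@prime_index_eq _ D); rewrite ?iAD ?subsetIl //.
    apply/subsetP=> z Dz; rewrite inC (subsetP sDA) //=.
    by rewrite (subsetP sZ0Z) ?comm_Z0.
  by apply: contra nDy => /subsetP->; rewrite // inC Ay.
by rewrite inC Ac => /andP[_].
Qed.

(** The element z' = [x, [x, c]] has order p and is a power of c^(p^k). With psi c = b^l c^n,
    evaluating psi z' on this power gives z'^n, and on the commutators z'^(i^2 n); moreover p does
    not divide n. *)
Let aut_square psi x i : psi \in Aut S -> x \in S -> x \notin A ->
  (x ^+ i)^-1 * psi x \in A -> i ^ 2 = 1 %[mod p].
Proof.
move=> Apsi Sx nAx.
have psiS y : y \in S -> psi y \in S by move=> Sy; apply: Aut_closed.
have psiR y z : y \in S -> z \in S -> psi [~ y, z] = [~ psi y, psi z].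
  by move=> Sy Sz; apply: (morphR (autm_morphism Apsi)).
move: (_ * psi x) (mulKVg (x ^+ i) (psi x)) => w def_psix Aw.
have Sw := subsetP sAS w Aw.
have Apsic : psi c \in A.
  apply: cent_b; first exact: psiS.
  (* As b = [a, c], its preimage stays in [S, S], hence in [D], and commutes with [c]; so psi c
     commutes with [b]. *)
  have Db' : psi^-1 b \in D.
    rewrite (subsetP commSS) //; have AV : psi^-1 \in Aut S by rewrite groupV.
    by rewrite -rel_ac (AutR AV) // mem_commg //; apply: Aut_closed.
  have Sb0 := subsetP sDS _ Db'.
  rewrite -[b](permKV psi); apply/commgP/eqP; rewrite -psiR //.
  rewrite commute_comm1 ?(Aut_morph1 Apsi) //.
  by apply: (centsP cAA) => //; apply: (subsetP sDA).
have [l [n psic]] : exists l n, psi c = b ^+ l * c ^+ n.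
  move: Apsic; rewrite -defA => /mulsgP[_ _ /cycleP[l ->] /cycleP[n ->] ->].
  by exists l, n.
pose b' := [~ x, c]; have /setDP[Db' nZb'] : b' \in D :\: Z by apply: comm_c.
have Sb' := subsetP sDS _ Db'.
pose z' := [~ x, b']; have Z0z' : z' \in Z0 by apply: comm_Z0.
have z'1 : z' != 1 by apply: comm_D_nontriv.
have Zz' : z' \in Z := subsetP sZ0Z _ Z0z'.
have [s def_z'] := cycleP _ _ Z0z'.
have psiz' : psi z' = z' ^+ n.
  rewrite def_z' -expgM (AutX _ Apsi) // psic expgMn; last first.
    by apply: commuteX2.
  (* Since k > 0, the exponent p^k has a factor p, which kills [b ^+ l]. *)
  rewrite -(prednK k_gt0) expnS -mulnA -expgM mulnCA expgM bp1 expg1n mul1g.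
  by rewrite -!expgM mulnC.
have oz' : #[z'] = p.
  apply: nt_prime_order => //; apply/eqP; rewrite def_z' -!expgM -order_dvdn oc.
  by rewrite mulnCA -expnSr dvdn_mull.
have wA y z : y \in S -> z \in A -> [~ y * w, z] = [~ y, z] .
  move=> Sy Az.
  rewrite commMgJ [[~ w, z]]commute_comm1 ?mulg1; last exact: (centsP cAA).
  apply/conjg_fixP/commgP; apply: (centsP cAA) => //.
  by rewrite (subsetP sDA) // comm_D // (subsetP sAS).
have N y : y \in S -> y \in 'N(Z) by apply: (subsetP nZS).
have psib' : psi b' = [~ x ^+ i, psi c].
  by rewrite psiR // -def_psix wA ?groupX.
have e_psib' : coset Z (psi b') = coset Z (b' ^+ (i * n)).
  have Dbl : b ^+ l \in D by rewrite groupX.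
  rewrite psib' psic commgMJ coset_mulr ?N ?groupR ?groupX //; last first.
    by rewrite memJ_norm ?N ?groupX // (subsetP sZ0Z) // comm_Z0 ?groupX.
  (* Modulo [Z] the commutator [x, c] is central, because [S, D] <= Z; so powers can be pulled out
     of commutators. *)
  have cX y : y \in S -> commute (coset Z y) [~ coset Z x, coset Z c].
    move=> Sy; apply/commgP; rewrite -!morphR ?N ?groupR //=.
    by apply/eqP/coset_id/(subsetP sZ0Z)/comm_Z0.
  rewrite morphR ?morphX ?N ?groupX ?groupR //= commXXg; try exact: cX.
  by rewrite -morphR ?N.
pose zeta := (b' ^+ (i * n))^-1 * psi b'.
have Zzeta : zeta \in Z.
  apply: coset_idr; first by rewrite groupM ?groupV ?groupX ?N ?psiS.
  by rewrite morphM ?morphV ?groupV ?N ?psiS ?groupX //= e_psib' mulVg.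
have psib'E : psi b' = b' ^+ (i * n) * zeta by rewrite mulKVg.
have /eqP : psi z' = z' ^+ (i * (i * n)).
  have Abz : b' ^+ (i * n) * zeta \in A.
    by rewrite groupM ?groupX // ?(subsetP sDA b') // (subsetP sZA).
  rewrite psiR // -def_psix psib'E wA ?groupX // commgMJ.
  rewrite [[~ _, zeta]]commute_comm1 ?mul1g; last by apply: cZ; rewrite ?groupX.
  rewrite commXXg -/z'; try by [apply: cZ | apply: commute_sym; apply: cZ].
  by apply/conjg_fixP/commgP/commute_sym/cZ; rewrite ?groupX ?(subsetP sZS).
rewrite psiz' eq_expg_mod_order oz' => /eqP e1.
have pn : ~~ (p %| n).
  apply: contra z'1 => /dvdnP[n' def_n].
  have psi1 : psi z' = psi 1.
    by rewrite psiz' def_n mulnC expgM -oz' expg_order expg1n (Aut_morph1 Apsi).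
  by rewrite (perm_inj psi1).
have [j [q nj]] := prime_modular_inverse pr_p pn.
have nj1 : n * j = 1 %[mod p] by rewrite nj mulnC modnMDl.
rewrite -[(i ^ 2)%N]muln1 -modnMmr -nj1 modnMmr expnS expn1.
by rewrite mulnA -[(i * i * n)%N]mulnA -modnMml -e1 modnMml nj1.
Qed.

(** An element of P :&: A outside [D] has a commutator with [x] in [D] but not in [Z]. Prime indices
    then force [P] to contain [D], then [A], then [S]. *)
Let meet_A (P : {group gT}) x : P \proper S -> Z \subset P -> x \in P -> x \notin A ->
  P :&: A = Z \/ P :&: A = D.
Proof.
move=> /andP[sPS nSP] sZP Px nAx; have Sx := subsetP sPS x Px.
have sZPA : Z \subset P :&: A by rewrite subsetI sZP.
have [sPAD | /subsetPn[y /setIP[Py Ay] nDy]] := boolP (P :&: A \subset D).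
  have [sPAZ | nsPAZ] := boolP (P :&: A \subset Z).
    by left; apply/eqP; rewrite eqEsubset sPAZ.
  by right; apply: (@prime_index_eq _ Z); rewrite ?iDZ.
have Sy := subsetP sAS y Ay.
have defPD : P :&: D = D.
  apply: (@prime_index_eq _ Z); rewrite ?iDZ ?subsetIr ?subsetI ?sZP //.
  apply: contra (comm_A_nontriv Sx nAx Ay nDy) => /subsetP; apply.
  by rewrite inE groupR //= comm_D.
have sDP : D \subset P by apply/setIidPr.
have defPA : P :&: A = A.
  apply: (@prime_index_eq _ D); rewrite ?iAD ?subsetIr ?subsetI ?sDP //.
  by apply: contra nDy => /subsetP; apply; rewrite inE Py.
case/negP: nSP; have -> // : P :=: S; apply: (@prime_index_eq _ A); rewrite ?iSA //.
  exact/setIidPr.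
by apply: contra nAx => /subsetP; apply.
Qed.

(** * Centric subgroups in a fusion system over [S] *)

Section Radical.

Hypothesis p_gt3 : (3 < p)%N.
Variables (F : fusion_system S) (P : {group gT}).
Hypotheses (prP : P \proper S) (cSP : 'C_S(P) \subset P).
Hypothesis sylP : p.-Sylow(AutF F P) (AutS S P).
Hypothesis extP : forall B : {group {perm gT}}, B \subset AutF F P ->
  AutS S P <| B -> forall al, al \in B -> extends_to_S F P al.

Let sPS : P \subset S. Proof. exact: proper_sub. Qed.
Let G := Group (AutF_group_set F sPS).
Let sGA : G \subset Aut P. Proof. exact: AutF_sub. Qed.
Let sylG : p.-Sylow(G) (AutS S P). Proof. exact: sylP. Qed.
Let M := (P :&: A)%G.
Let sMP : M \subset P. Proof. exact: subsetIl. Qed.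
Let pP : p.-group P. Proof. exact: pgroupS pS. Qed.

Let sZP : Z \subset P.
Proof.
by rewrite (subset_trans _ cSP) // (subset_trans sZcent) // setIS // centS.
Qed.

Let conj_G h : h \in 'N_S(P) -> conj_aut P h \in G.
Proof. by move=> Nh; apply: (subsetP (pHall_sub sylG)); apply: conj_aut_AutS. Qed.

(** A centric subgroup inside the abelian [A] is [A] itself, of type (p, p^(k+1)). *)
Let AutS_normal_sub : P \subset A -> AutS S P <| AutF F P.
Proof.
move=> sPA; have defP : P :=: A.
  apply/eqP; rewrite eqEsubset sPA (subset_trans _ cSP) // subsetI sAS.
  by rewrite centsC (subset_trans sPA).
apply: (@abelian_Sylow_normal _ p k.-1 P b c G [group of AutS S P]) => //.
- by rewrite defP.
- by rewrite defA.
by rewrite prednK.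
Qed.

Section NotInA.

Variable x : gT.
Hypotheses (Px : x \in P) (nAx : x \notin A).
Let Sx : x \in S. Proof. exact: (subsetP sPS). Qed.

Let iPM : #|P : M| = p.
Proof.
rewrite indexgI -[#|P : A|]indexMg -iSA; congr #|_ : A|.
have nAP : P \subset 'N(A) := subset_trans sPS nAS.
rewrite -norm_joinEr //; apply: (@prime_index_eq _ A); rewrite ?iSA ?joing_subl //.
  by rewrite join_subG sAS.
by apply: contra nAx => /subsetP; apply; apply: (subsetP (joing_subr _ _)).
Qed.

Let nMP : M <| P.
Proof. by rewrite /normal sMP normsI ?normG // (subset_trans sPS nAS). Qed.

Let cycPM : cyclic (P / M).
Proof. by rewrite prime_cyclic // card_quotient ?normal_norm // iPM. Qed.

Let casesM : (M :=: Z) + (M :=: D).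
Proof.
case: (M =P Z :> {set gT}) => [|nMZ]; first by left.
by right; case: (meet_A prP sZP Px nAx).
Qed.

Let B := [set al in G | [forall y in M, al y \in M]].

Let inB al : reflect (al \in G /\ {in M, forall y, al y \in M}) (al \in B).
Proof. by apply: (iffP setIdP) => -[Gal /forall_inP]. Qed.

Let B_group_set : group_set B.
Proof.
apply/group_setP; split=> [|u v /inB[Gu uM] /inB[Gv vM]].
  by apply/inB; rewrite group1; split=> // y; rewrite perm1.
by apply/inB; split=> [|y My]; rewrite ?groupM // permM vM ?uM.
Qed.
Let BG := Group B_group_set.

(** This makes [Z] characteristic in [P]. A central element of [P] commutes with [b], so it lies in
    P :&: A = D; commuting with [x], it lies in [Z]. *)
Let centerP : M :=: D -> 'Z(P) = Z.
Proof.
move=> defM; apply/eqP; rewrite eqEsubset subsetI sZP /=; apply/andP; split.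
  apply/subsetP=> y /setIP[Py Cy]; have Sy := subsetP sPS y Py.
  have sDP : D \subset P by rewrite -defM.
  have Ay : y \in A.
    by apply: cent_b => //; apply: (centP Cy); apply: (subsetP sDP).
  have Dy : y \in D by rewrite -defM inE Py.
  apply: contraT => nZy; case/eqP: (comm_D_nontriv Sx nAx Dy nZy).
  by apply: commute_comm1; apply: commute_sym; apply: (centP Cy).
by rewrite (subset_trans sZcent) // (subset_trans (subsetIr _ _)) // centS.
Qed.

Let stable_Z : M :=: D -> stable_under G Z.
Proof.
move=> defM al Gal y; have Aal := subsetP sGA al Gal.
rewrite -(centerP defM) => /setIP[Py /centP Cy]; apply/setIP.
split; first exact: Aut_closed.
have AalV : al^-1 \in Aut P by rewrite groupV.
apply/centP=> v Pv; rewrite -[v](permKV al) /commute.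
by rewrite -!(AutM Aal) ?Aut_closed // Cy ?Aut_closed.
Qed.

(** The chain Z <= M <= P has cyclic factors and is stable under [B]; Aut_S(P) lies in [B] because
    [A] is normal in [S]. *)
Let normalB : AutS S P <| BG.
Proof.
have sZM : Z \subset M by rewrite subsetI sZP.
apply: (@chain_Sylow_normal _ p P M Z BG [group of AutS S P]) => //.
- by apply: subset_trans sGA; apply/subsetP=> al /inB[].
- by rewrite /normal sZM (subset_trans sMP) // (subset_trans sPS).
- by move=> al /inB[].
- case: casesM => [defM | defM] al /inB[Gal alM]; last exact: stable_Z.
  by rewrite -defM.
- exact: cycle_cyclic.
- case: casesM => defM; first by rewrite -defM trivg_quotient cyclic1.
  rewrite [_ / _](congr1 (quotient^~ Z) defM) prime_cyclic // card_quotient ?iDZ //.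
  exact: subset_trans sDS nZS.
apply: (pHall_subl _ _ sylG); last by apply/subsetP=> al /inB[].
apply/subsetP=> al AFal; apply/inB; split; first exact: (subsetP (pHall_sub sylG)).
have [h /setIP[Sh Nh] alE] := AutS_mem AFal.
move=> y /setIP[Py Ay]; rewrite alE // inE !memJ_norm ?Py //.
exact: (subsetP nAS).
Qed.

Let stable_all : stable_under G M -> AutS S P <| AutF F P.
Proof.
move=> GM; suff <- : BG :=: AutF F P by apply: normalB.
apply/setP=> al; apply/inB/idP => [[] //|Gal]; split=> //; exact: GM.
Qed.

Let def_p : p = p./2.*2.+1.
Proof.
have odd_p : odd p by apply: contraLR p_gt3 => /(prime_oddPn pr_p) ->.
by rewrite -{1}(odd_double_half p) odd_p.
Qed.

(** The exponent [p./2.+1] is (p + 1) / 2, the inverse of 2 modulo p. Such an [al] lies in [B], so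
    it extends to [S]; [aut_square] then yields 4 = 1 modulo p, whereas p > 3. *)
Let no_moved al m : al \in G -> stable_under [set al] M -> m \in P -> m \notin M ->
  ~ (m ^+ p./2.+1)^-1 * al m \in M.
Proof.
move=> Gal alM Pm nMm Mm.
have Bal : al \in BG by apply/inB; split=> //; apply: alM; rewrite inE.
have sBG : BG \subset AutF F P by apply/subsetP=> ? /inB[].
have [psi AFpsi psiE] := extP sBG normalB Bal.
have [Apsi _] := AutFP _ _ _ AFpsi.
have nAm : m \notin A by apply: contra nMm => Am; rewrite inE Pm.
have e1 : p./2.+1 ^ 2 = 1 %[mod p].
  apply: (@aut_square psi m _ Apsi (subsetP sPS m Pm) nAm).
  by rewrite psiE //; case/setIP: Mm.
have e2 : 4 = 1 %[mod p].
  rewrite -[in LHS](muln1 4) -modnMmr -e1 modnMmr -(expnMn 2 _ 2).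
  have -> : (2 * p./2.+1 = p + 1)%N by rewrite mul2n doubleS [in RHS]def_p addn1.
  by rewrite -modnXm modnDl modnXm exp1n.
move/eqP: e2; rewrite eqn_mod_dvd // => /(dvdn_leq (isT : 0 < 3)%N).
by rewrite leqNgt p_gt3.
Qed.

Lemma AutS_normal_notin : AutS S P <| AutF F P.
Proof.
case: (boolP [forall al in G, forall y in M, al y \in M]) => [/forall_inP GM | nGM].
  by apply: stable_all => al Gal; apply/forall_inP/GM.
have {}nGM : ~ stable_under G M.
  by move=> GM; case/negP: nGM; apply/forall_inP=> al Gal; apply/forall_inP/GM.
have nAP y : y \in P -> y \notin M -> y \notin A.
  by move=> Py; apply: contra => Ay; rewrite inE Py.
have stP y : y \in P -> y \in S by apply: (subsetP sPS).
have nZP : P \subset 'N(Z) := subset_trans sPS nZS.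
have tE h y : h \in 'N_S(P) -> y \in P -> y^-1 * conj_aut P h y = [~ y, h].
  by move=> /setIP[_ Nh] Py; rewrite norm_conj_autE.
have NSP h : h \in S -> (forall y, y \in P -> [~ y, h] \in P) -> h \in 'N_S(P).
  move=> Sh PhP; rewrite 2!inE Sh /=; apply/subsetP=> _ /imsetP[y Py ->].
  by rewrite conjg_mulR groupM ?PhP.
have [defM | defM] := casesM; last first.
  have sDP : D \subset P by rewrite -defM.
  (* For M = D, the transvection is conjugation by [c] on P / Z. *)
  have Nc : c \in 'N_S(P).
    by apply: NSP => // y /[dup]Py /stP Sy; rewrite (subsetP sDP) // comm_D.
  case: (@moved_section _ p P Z M G (conj_aut P c)
           _ _ _ _ _ _ _ _ _ _ _ p./2 def_p nGM) => //.
  - by rewrite defM.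
  - apply: (@card_p2group_abelian _ p) => //.
    rewrite card_quotient // -(Lagrange_index (H := M)) ?iPM //; last by rewrite defM.
    by rewrite (congr1 (fun H : {set gT} => #|H : Z|) defM) iDZ.
  - by rewrite (congr1 (fun H : {set gT} => #|H : Z|) defM) iDZ.
  - exact: stable_Z.
  - exact: conj_G.
  - move=> y /setIP[Py Ay]; rewrite tE // commute_comm1 //.
    exact: (centsP cAA).
  - move=> y Py nMy; rewrite tE // (congr1 (fun H : {set gT} => H :\: Z) defM).
    by rewrite comm_c ?stP ?nAP.
  by move=> al [m [Gal alM Pm nMm Mm]]; case: (no_moved Gal alM Pm nMm Mm).
have cPP : abelian P.
  apply: (@cyclic_factor_abelian _ M); last exact: cycPM.
  rewrite subsetI sMP defM (subset_trans sZcent) //.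
  by rewrite (subset_trans (subsetIr _ _)) // centS.
have cP := centsP cPP.
have [k1 | k_neq1] := eqVneq k 1%N.
  (* For M = Z and k = 1, Z = Z0 has order p, and the transvection is conjugation by [b] on [P], of
     order p^2. *)
  have Nb : b \in 'N_S(P).
    apply: NSP => // y Py; rewrite (subsetP sZP) // (subsetP sZ0Z) //.
    by rewrite comm_Z0 ?stP.
  case: (@moved_section _ p P 1%G M G (conj_aut P b)
           _ _ _ _ _ _ _ _ _ _ _ p./2 def_p nGM) => //.
  - exact: sub1G.
  - exact: cents_norm (cents1 _).
  - exact: quotient_abelian.
  - by rewrite indexg1 (congr1 (fun H : {set gT} => #|H|) defM) oZ k1 expn1.
  - move=> al Gal _ /set1P->; apply/set1P.
    exact: Aut_morph1 (subsetP sGA al Gal).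
  - exact: conj_G.
  - move=> y /setIP[Py Ay]; rewrite tE // commute_comm1 ?group1 //.
    exact: (centsP cAA).
  - move=> y Py nMy; rewrite tE // (congr1 (fun H : {set gT} => H :\: 1) defM).
    rewrite inE (subsetP sZ0Z) ?comm_Z0 ?stP // andbT.
    by rewrite inE comm_b ?stP ?nAP.
  by move=> al [m [Gal alM Pm nMm Mm]]; case: (no_moved Gal alM Pm nMm Mm).
have k_ge2 : (1 < k)%N by rewrite ltn_neqAle eq_sym k_neq1.
have Zxp : x ^+ p \in Z.
  have: x ^+ p \in M; last by rewrite -defM.
  have Nx : x \in 'N(M) by apply: (subsetP (normal_norm nMP)).
  apply: coset_idr; rewrite ?groupX // morphX //=; apply/eqP.
  rewrite -order_dvdn -iPM -card_quotient ?normal_norm // order_dvdG //.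
  exact: mem_quotient.
have [i def_xp] := cycleP _ _ Zxp.
have [/dvdnP[i' def_i] | npi] := boolP (p %| i).
  (* [y] is a p-th root of x^p in [Z]; dividing [x] by it gives [u] of order p, so that P = <u> Z
     has type (p, p^k). *)
  pose y := c ^+ (p * i'); pose u := x * y^-1.
  have Zy : y \in Z by rewrite /y expgM mem_cycle.
  have Py := subsetP sZP y Zy.
  have up : u ^+ p = 1.
    rewrite expgMn; last by apply: cP; rewrite ?groupV.
    by rewrite def_xp def_i expgVn /y -!expgM mulnA mulgV.
  have Pu : u \in P by rewrite groupM ?groupV.
  have nMu : u \notin M.
    by rewrite inE Pu /= groupMr ?groupV // (subsetP sZA).
  apply: (@abelian_Sylow_normal _ p (k - 2) P u (c ^+ p) G [group of AutS S P]) => //.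
    rewrite -[<[c ^+ p]>]/(gval Z) -cent_joinEr; last first.
      by rewrite (subset_trans sZP) // (subset_trans cPP) // centS ?cycle_subG.
    apply: (@prime_index_eq _ M); rewrite ?iPM //.
    - by rewrite defM joing_subr.
    - by rewrite join_subG cycle_subG Pu.
    apply: contra nMu => /subsetP; apply.
    by rewrite (subsetP (joing_subl _ _)) ?cycle_id.
  by rewrite -[LHS]/#|Z| oZ -addn2 subnK.
(* Now x^p generates [Z], so [P] is cyclic, generated by [x], and M = <x^p> cannot be moved. *)
case: nGM.
have defZ : <[x ^+ p]> = Z.
  rewrite def_xp; apply/esym/eqP.
  rewrite -[_ == _]/(generator Z _) generator_coprime.
  by rewrite -[#[_]]/#|Z| oZ coprimeXl // prime_coprime.
have defP : <[x]> = P.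
  apply: (@prime_index_eq _ M); rewrite ?iPM ?cycle_subG //.
    by rewrite defM -defZ cycle_subG mem_cycle.
  by apply: contra nAx => /setIP[].
have defM' : gval M = <[x ^+ p]> by rewrite defM defZ.
have sM : stable_under G <[x ^+ p]>.
  apply: (@stable_cycle _ P) => // [|al Gal]; first exact: groupX.
  have Aal := subsetP sGA al Gal; rewrite (AutX _ Aal) //.
  have: al x \in P by apply: Aut_closed.
  by rewrite -{1}defP => /cycleP[j ->]; rewrite -expgM mulnC expgM mem_cycle.
move=> al Gal y; rewrite -[y \in M]/(y \in gval M).
by rewrite -[al y \in M]/(al y \in gval M) defM'; apply: sM.
Qed.

End NotInA.

Lemma AutS_normal : AutS S P <| AutF F P.
Proof.
have [sPA | /subsetPn[x Px nAx]] := boolP (P \subset A).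
  exact: AutS_normal_sub.
exact: (AutS_normal_notin Px nAx).
Qed.

End Radical.

Theorem resistant_of_structure : (3 < p)%N -> resistant p S.
Proof.
move=> p_gt3 F satF; apply: (resistance_criterion satF pS).
by move=> P prP cSP sylP extP; apply: AutS_normal.
Qed.

End Structure.

(** * The order of G(p, r; e) *)

Section Model.

Import GRing.Theory.

Variables (p k e : nat).
Hypotheses (pr_p : prime p) (p_gt2 : (2 < p)%N) (k_gt0 : (0 < k)%N).
Local Notation q := (p ^ k.+1)%N.

Let p_gt1 : (1 < p)%N. Proof. exact: prime_gt1. Qed.
Let p_gt0 : (0 < p)%N. Proof. exact: prime_gt0. Qed.
Let q_gt1 : (1 < q)%N. Proof. by rewrite (ltn_exp2l 0). Qed.

Local Open Scope ring_scope.

Lemma Zp_natr_modn (d n m : nat) : (1 < n)%N -> (n %| d)%N ->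
  (m %% d)%:R = m%:R :> 'Z_n.
Proof.
move=> n_gt1 /dvdnP[s ->]; rewrite [in RHS](divn_eq m (s * n)) natrD !natrM.
by rewrite pchar_Zp // !mulr0 add0r.
Qed.

Let red (j : 'Z_q) : 'Z_p := (j : nat)%:R.
Let emb (i : 'Z_p) : 'Z_q := (e * p ^ k * i)%:R.

Let red_nat n : red n%:R = n%:R.
Proof. by rewrite /red val_Zp_nat // Zp_natr_modn // dvdn_exp. Qed.

Let emb_nat n : emb n%:R = (e * p ^ k * n)%:R.
Proof.
rewrite /emb val_Zp_nat // [in RHS](divn_eq n p) mulnDr natrD mulnCA -!mulnA.
by rewrite -expnSr !natrM pchar_Zp // !mulr0 add0r.
Qed.

Let redD i j : red (i + j) = red i + red j.
Proof. by rewrite -[i]natr_Zp -[j]natr_Zp -natrD !red_nat natrD. Qed.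

Let embD i j : emb (i + j) = emb i + emb j.
Proof. by rewrite -[i]natr_Zp -[j]natr_Zp -natrD !emb_nat mulnDr natrD. Qed.

Let red_emb i : red (emb i) = 0.
Proof.
rewrite -[i]natr_Zp emb_nat red_nat -(prednK k_gt0) expnS -!mulnA mulnCA natrM.
by rewrite pchar_Zp // mul0r.
Qed.

Let emb0 : emb 0 = 0. Proof. by rewrite -[0]/(0%:R) emb_nat muln0. Qed.

Let embN i : emb (- i) = - emb i.
Proof. by apply/eqP; rewrite -addr_eq0 -embD addNr emb0. Qed.

(** The model is a semidirect product acting on Z_p x Z_q: [fb] and [fc] are translations, and [fa]
    is an additive automorphism of order p. *)
Let T := ('Z_p * 'Z_q)%type.
Let fa (x : T) : T := (x.1 - red x.2, x.2 + emb x.1).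
Let fb (x : T) : T := (x.1 + 1, x.2).
Let fc (x : T) : T := (x.1, x.2 + 1).

(** [red] kills the image of [emb], so each step subtracts the same amount from the first
    coordinate; summing the first coordinates gives the binomial coefficient. *)
Let iter_fa n x :
  iter n fa x = (x.1 - red x.2 *+ n, x.2 + emb (x.1 *+ n - red x.2 *+ 'C(n, 2))).
Proof.
elim: n => [|n IHn] /=; first by rewrite !mulr0n !subr0 emb0 addr0; case: x.
rewrite IHn /fa /=; congr (_, _).
  by rewrite redD red_emb addr0 mulrSr opprD addrA.
rewrite -addrA -embD; congr (_ + emb _).
by rewrite binS bin1 mulrSr mulrnDr opprD addrACA.
Qed.

Let mulrp (i : 'Z_p) : i *+ p = 0.
Proof. by rewrite -mulr_natr pchar_Zp // mulr0. Qed.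

Let iter_fa_p : iter p fa =1 id.
Proof.
move=> x; rewrite iter_fa.
(* This divisibility is where p > 2 enters. *)
have /dvdnP[s ->] : (p %| 'C(p, 2))%N by rewrite prime_dvd_bin // p_gt2.
by rewrite mulnC mulrnA !mulrp mul0rn subrr emb0 subr0 addr0; case: x.
Qed.

Let fa_inj : injective fa.
Proof.
apply: (can_inj (g := iter p.-1 fa)) => x.
by rewrite -iterSr prednK // iter_fa_p.
Qed.

Let fb_inj : injective fb.
Proof.
apply: (can_inj (g := fun x : T => (x.1 - 1, x.2))) => -[i j].
by rewrite /fb /= addrK.
Qed.

Let fc_inj : injective fc.
Proof.
apply: (can_inj (g := fun x : T => (x.1, x.2 - 1))) => -[i j].
by rewrite /fc /= addrK.
Qed.

Let iter_fb n x : iter n fb x = (x.1 + n%:R, x.2).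
Proof.
by elim: n => [|n IHn] /=; [rewrite addr0; case: x | rewrite IHn /fb /= mulrSr addrA].
Qed.

Let iter_fc n x : iter n fc x = (x.1, x.2 + n%:R).
Proof.
by elim: n => [|n IHn] /=; [rewrite addr0; case: x | rewrite IHn /fc /= mulrSr addrA].
Qed.

Local Open Scope group_scope.

Let a := perm fa_inj.
Let b := perm fb_inj.
Let c := perm fc_inj.

Let aX n x : (a ^+ n) x = iter n fa x.
Proof. by rewrite permX; apply: eq_iter => y; rewrite permE. Qed.
Let bX n x : (b ^+ n) x = iter n fb x.
Proof. by rewrite permX; apply: eq_iter => y; rewrite permE. Qed.
Let cX n x : (c ^+ n) x = iter n fc x.
Proof. by rewrite permX; apply: eq_iter => y; rewrite permE. Qed.

Let bV x : b^-1 x = (x.1 - 1, x.2)%R.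
Proof.
by apply: (perm_inj (s := b)); rewrite permKV permE /fb /= subrK; case: x.
Qed.

Let commg_eq (gT : finGroupType) (x y z : gT) : x * y = y * x * z -> [~ x, y] = z.
Proof. by move=> e1; apply: (mulgI (y * x)); rewrite -commgC. Qed.

(** The translations are transitive on the p^(k+2) points and [a], of order p, fixes the origin, so
    orbit-stabilizer gives the order bound. *)
Lemma presented_group_model : exists (gT : finGroupType) (H : {group gT}),
  H \homg Grp (a : b : c :
    a ^+ p, b ^+ p, c ^+ (p ^ k.+1)%N, [~ b, c],
    [~ a, b^-1] = c ^+ (e * p ^ k)%N, [~ a, c] = b) /\ (p ^ k.+3 <= #|H|)%N.
Proof.
exists [the finGroupType of {perm T}], (<[a]> <*> <[b]> <*> <[c]>)%G; split.
  apply/existsP; exists (a, b, c); rewrite /= !xpair_eqE /=.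
  rewrite eqxx /=; apply/and5P; split; last (apply/andP; split); apply/eqP.
  - by apply/permP=> x; rewrite aX iter_fa_p perm1.
  - by apply/permP=> x; rewrite bX iter_fb pchar_Zp // addr0 perm1; case: x.
  - by apply/permP=> x; rewrite cX iter_fc pchar_Zp // addr0 perm1; case: x.
  - by apply: commg_eq; apply/permP=> x; rewrite mulg1 !permM !permE.
  - apply: commg_eq; apply/permP=> x; rewrite !permM cX iter_fc !bV !permE /fa /=.
    congr (_, _); first by rewrite addrAC.
    have -> : (e * p ^ k)%:R = emb 1%R.
      by rewrite -[in LHS](muln1 (e * p ^ k)%N) -emb_nat.
    by rewrite embD embN addrA subrK.
  - apply: commg_eq; apply/permP=> x; rewrite !permM !permE /fa /fb /fc /=.
    congr (_, _); last by rewrite addrAC.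
    have red1 : (red 1 = 1)%R := red_nat 1.
    by rewrite redD red1 opprD addrA subrK.
set H := (_ <*> _)%G; pose x0 : T := (0, 0)%R.
have Ha : a \in H.
  by rewrite !(subsetP (joing_subl _ _)) ?cycle_id.
have Hb : b \in H.
  by rewrite (subsetP (joing_subl _ _)) // (subsetP (joing_subr _ _)) ?cycle_id.
have Hc : c \in H by rewrite (subsetP (joing_subr _ _)) ?cycle_id.
have orbH : orbit 'P H x0 = setT.
  apply/setP=> -[i j]; rewrite inE; apply/orbitP; exists (b ^+ i * c ^+ j).
    by rewrite groupM ?groupX.
  by rewrite /= apermE permM bX cX iter_fc iter_fb /= !add0r !natr_Zp.
have red0 : (red 0 = 0)%R := red_nat 0.
have red1 : (red 1 = 1)%R := red_nat 1.
have a0 : a x0 = x0 by rewrite permE /fa /= emb0 red0 subr0 addr0.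
have a_neq1 : a != 1.
  apply/eqP=> /permP/(_ (0, 1)%R)/(congr1 fst)/eqP.
  by rewrite perm1 permE /fa /= red1 sub0r oppr_eq0 oner_eq0.
have oa : #[a] = p.
  by apply: nt_prime_order => //; apply/permP=> x; rewrite aX iter_fa_p perm1.
have oT : #|[set: T]| = (p * q)%N by rewrite cardsT card_prod !card_ord !Zp_cast.
have : #[a] %| #|'C_H[x0 | 'P]|.
  by rewrite order_dvdG // inE Ha; apply/astab1P.
rewrite oa => /dvdn_leq le_p.
by rewrite -(card_orbit_stab 'P H x0) orbH oT -expnS expnSr leq_mul2l le_p ?orbT.
Qed.

End Model.

(** * From the presentation to the structure of [S] *)

Lemma leq_card_mulg (gT : finGroupType) (H K : {group gT}) :
  (#|(H * K)%g| <= #|H| * #|K|)%N.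
Proof. by rewrite mul_cardG leq_pmulr. Qed.

(** The relations give S = <a><b><c>, of order at most p * p * p^(k+1). The model is an image of
    [S], so no factor can be smaller or overlap: this yields the order of [c], and [b] outside <c>,
    and [a] outside [A]. *)
Theorem theorem4p3 (p r e : nat) (gT : finGroupType) (S : {group gT}) :
  prime p -> (3 < p)%N -> (4 <= r)%N ->
  e = 1%N \/ quadratic_nonresidue p e ->
  S \isog Grp (a : b : c :
    a ^+ p, b ^+ p, c ^+ (p ^ (r - 2))%N, [~ b, c],
    [~ a, b^-1] = c ^+ (e * p ^ (r - 3))%N, [~ a, c] = b) ->
  resistant p S.
Proof.
move=> pr_p p_gt3 r_ge4 e_def isoS.
have ndiv_pe : ~~ (p %| e).
  case: e_def => [-> | nonres]; first by rewrite dvdn1 neq_ltn prime_gt1 ?orbT.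
  (* Non-residuosity tested at x = 0 says that p does not divide e. *)
  by have := nonres 0; rewrite exp0n // mod0n eq_sym.
have [k def_r] : exists k, r = k.+3 by exists (r - 3)%N; rewrite -addn3 subnK // ltnW.
have k_gt0 : (0 < k)%N by move: r_ge4; rewrite def_r.
move: isoS; rewrite {}def_r !subSS !subn0 => isoS.
have [rT [H [homH oH]]] := presented_group_model e pr_p (ltnW p_gt3) k_gt0.
have /homgP[f defH] : H \homg S by rewrite (isoS rT H).
have {}oH : (p ^ k.+3 <= #|S|)%N.
  by rewrite (leq_trans oH) // -defH leq_morphim.
have := isoGrp_hom isoS; case/existsP=> -[[a b] c] /=.
rewrite !xpair_eqE /= => /andP[/eqP defS].
move=> /and5P[/eqP ap1 /eqP bp1 /eqP cq1 /eqP rel_bc].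
move=> /andP[/eqP rel_ab /eqP rel_ac].
have p_gt0 := prime_gt0 pr_p.
have ob_le : (#[b] <= p)%N by rewrite dvdn_leq // order_dvdn bp1.
have oa_le : (#[a] <= p)%N by rewrite dvdn_leq // order_dvdn ap1.
have dvd_oc : #[c] %| p ^ k.+1 by rewrite order_dvdn cq1.
pose A := <<[set b; c]>>%G.
have cbc : commute b c by apply/commgP/eqP.
have joinA : <[b]> <*> <[c]> = A by rewrite joing_idl joing_idr.
have defA : <[b]> * <[c]> = A.
  by rewrite -joinA cent_joinEr // cycle_subG /= cent_cycle; apply/cent1P/commute_sym.
have Ab : b \in A by rewrite mem_gen // !inE eqxx.
have Ac : c \in A by rewrite mem_gen // !inE eqxx orbT.
have nAa : a \in 'N(A).
  rewrite inE -genJ gen_subG; apply/subsetP=> _ /imsetP[x /set2P[->|->] ->].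
    have -> : b ^ a = c ^+ (e * p ^ k) * b by rewrite -rel_ab commgEr invgK mulgKV.
    by rewrite groupM ?groupX.
  have -> : c ^ a = c * b^-1 by rewrite -rel_ac commgEr conjVg invMg invgK mulKVg.
  by rewrite groupM ?groupV.
have defS' : <[a]> * A = S.
  by rewrite -norm_joinEl ?cycle_subG // -joinA joingA.
have oS_le : (#|S| <= p * #|A|)%N.
  by rewrite -defS' (leq_trans (leq_card_mulg _ _)) // leq_mul2r oa_le orbT.
have pk n : (p ^ n < p ^ n.+1)%N by rewrite ltn_exp2l ?prime_gt1.
have oA_ge : (p ^ k.+2 <= #|A|)%N.
  by rewrite -(leq_pmul2l p_gt0) -expnS (leq_trans oH).
have oA_le : (#|A| <= p * #[c])%N.
  by rewrite -defA (leq_trans (leq_card_mulg _ _)) // leq_mul2r ob_le orbT.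
have oc : #[c] = (p ^ k.+1)%N.
  apply/eqP; rewrite eqn_leq dvdn_leq ?expn_gt0 ?p_gt0 //=.
  by rewrite -(leq_pmul2l p_gt0) -expnS (leq_trans oA_ge).
have nbc : b \notin <[c]>.
  apply: contraL oA_ge => bc; rewrite -ltnNge -defA mulSGid ?cycle_subG //.
  by rewrite -orderE oc.
have naA : a \notin A.
  apply: contraL oH => aA; rewrite -ltnNge -defS' mulSGid ?cycle_subG //.
  by rewrite (leq_ltn_trans oA_le) // oc -expnS.
have -> : S = <<[set a; b; c]>>%G.
  apply: val_inj; rewrite /= -defS -joingA [X in _ <*> X]joinA joing_idl joing_idr.
  by rewrite joingE setUA.
exact: (resistant_of_structure pr_p k_gt0 ndiv_pe ap1 bp1 oc).
Qed.
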